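(* As formal power series in $z$ and $p$, $$\sum_{\substack{n\ge0\\ \pi\in B_n}}\frac{z^n}{(p;q^2)_{n+1}}\,q^{\mathrm{fmaj}(\pi)}t^{\mathrm{fexc}(\pi)}p^{\mathrm{des}_{\mathrm B}(\pi)}r^{\mathrm{fix}^+(\pi)}s^{\mathrm{neg}(\pi)}$$ $$=\sum_{k\ge0}\frac{p^k(1-t^2q^2)(z;q^2)_k(t^2q^2z;q^2)_k}{(rz;q^2)_{k+1}\left[(1+sqt)(z;q^2)_k-(t^2q^2+sqt)(t^2q^2z;q^2)_k\right]}.$$
   Context: $[n]=\{1,\dots,n\}$; $(a;q)_0=1$ and $(a;q)_n=(1-a)(1-aq)\cdots(1-aq^{n-1})$ for $n\ge1$ (so $(a;q^2)_n$ uses base $q^2$). $B_n$ is the hyperoctahedral group of signed permutations: words $\pi=\pi_1\cdots\pi_n$ with $\pi_i\in\{\pm1,\dots,\pm n\}$ such that $|\pi_1|\cdots|\pi_n|$ is a permutation of $[n]$. All comparisons are in the natural order on $\mathbb Z$. Let $\mathrm{DES}(\pi)=\{i\in[n-1]:\pi_i>\pi_{i+1}\}$, $\mathrm{des}(\pi)=|\mathrm{DES}(\pi)|$, $\mathrm{maj}(\pi)=\sum_{i\in\mathrm{DES}(\pi)}i$, $\mathrm{exc}(\pi)=|\{i\in[n]:\pi_i>i\}|$, $\mathrm{neg}(\pi)=|\{i\in[n]:\pi_i<0\}|$, $\mathrm{fix}^+(\pi)=|\{i\in[n]:\pi_i=i\}|$. Then $\mathrm{des}_{\mathrm B}(\pi)=\mathrm{des}(\pi)+\chi(\pi_1<0)$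 (with $\chi(P)=1$ if $P$ is true and $0$ otherwise), $\mathrm{fmaj}(\pi)=2\,\mathrm{maj}(\pi)+\mathrm{neg}(\pi)$, $\mathrm{fexc}(\pi)=2\,\mathrm{exc}(\pi)+\mathrm{neg}(\pi)$. For $n=0$ there is only the empty word, all of whose statistics are zero. *)

(* Defs.v *)
From HB Require Import structures.
From mathcomp Require Import all_boot all_order all_algebra all_fingroup.
From mathcomp Require Import boolp.

Set Implicit Arguments.
Unset Strict Implicit.
Unset Printing Implicit Defensive.

Import Order.TTheory GRing.Theory Num.Theory.
Local Open Scope ring_scope.

(* The coefficient of degree [n] of [f] is [f n]. *)
Record fps (R : Type) := FPS { fps_coef :> nat -> R }.

Arguments FPS {R} _.

Notation "{ 'fps' R }" := (fps R) (at level 0, format "{ 'fps'  R }").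

HB.instance Definition _ (R : Type) := gen_eqMixin {fps R}.
HB.instance Definition _ (R : Type) := gen_choiceMixin {fps R}.

Lemma fpsP (R : Type) (f g : {fps R}) :
  (forall i, f i = g i) -> f = g.
Proof. by case: f g => [f] [g] /= /funext->. Qed.

Section FpsZmodule.
Variable R : zmodType.
Implicit Types f g : {fps R}.

Definition fps_zero : {fps R} := FPS (fun=> 0).
Definition fps_opp f := FPS (fun n => - f n).
Definition fps_add f g := FPS (fun n => f n + g n).

Lemma fps_addA : associative fps_add.
Proof. by move=> f g h; apply: fpsP => i; apply: addrA. Qed.
Lemma fps_addC : commutative fps_add.
Proof. by move=> f g; apply: fpsP => i; apply: addrC. Qed.
Lemma fps_add0 : left_id fps_zero fps_add.
Proof. by move=> f; apply: fpsP => i; apply: add0r. Qed.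
Lemma fps_addN : left_inverse fps_zero fps_opp fps_add.
Proof. by move=> f; apply: fpsP => i; apply: addNr. Qed.

HB.instance Definition _ := GRing.isZmodule.Build {fps R}
  fps_addA fps_addC fps_add0 fps_addN.

Lemma coef_fps0 n : (0 : {fps R}) n = 0. Proof. by []. Qed.
Lemma coef_fpsN f n : (- f) n = - f n. Proof. by []. Qed.
Lemma coef_fpsD f g n : (f + g) n = f n + g n. Proof. by []. Qed.

Lemma coef_fps_sum (I : Type) (r : seq I) (P : pred I) (F : I -> {fps R}) n :
  (\sum_(i <- r | P i) F i) n = \sum_(i <- r | P i) (F i) n.
Proof. exact: (big_morph (fun f : {fps R} => f n) (fun=> fun=> erefl)). Qed.

End FpsZmodule.

Section FpsRing.
Variable R : comNzRingType.
Implicit Types f g h : {fps R}.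

Definition fpsC (c : R) : {fps R} := FPS (fun n => if n is 0 then c else 0).
Definition fpsX : {fps R} := FPS (fun n => (n == 1)%:R).

Definition fps_mul f g : {fps R} :=
  FPS (fun n => \sum_(i < n.+1) f i * g (n - i)%N).

Definition fps_trunc N f : {poly R} := \poly_(i < N) f i.

Lemma coef_fps_mul_trunc N f g n : (n < N)%N ->
  (fps_mul f g) n = (fps_trunc N f * fps_trunc N g)`_n.
Proof.
move=> nN; rewrite coefM /=; apply: eq_bigr => i _.
rewrite !coef_poly (leq_ltn_trans (leq_subr _ _) nN).
by rewrite (leq_ltn_trans _ nN) // -ltnS.
Qed.

Lemma fps_mulC : commutative fps_mul.
Proof.
move=> f g; apply: fpsP => n.
by rewrite !(@coef_fps_mul_trunc n.+1) // mulrC.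
Qed.

Lemma fps_mulA : associative fps_mul.
Proof.
move=> f g h; apply: fpsP => n.
have tr a b m : (m < n.+1)%N ->
    (fps_trunc n.+1 (fps_mul a b))`_m =
    (fps_trunc n.+1 a * fps_trunc n.+1 b)`_m.
  by move=> mn; rewrite coef_poly mn (@coef_fps_mul_trunc n.+1).
rewrite !(@coef_fps_mul_trunc n.+1) //.
transitivity ((fps_trunc n.+1 f * (fps_trunc n.+1 g * fps_trunc n.+1 h))`_n).
  rewrite !coefM; apply: eq_bigr => i _; congr (_ * _).
  by apply: tr; rewrite ltnS leq_subr.
rewrite mulrA !coefM; apply: eq_bigr => i _; congr (_ * _).
by apply/esym/tr.
Qed.

Lemma fps_mul1 : left_id (fpsC 1) fps_mul.
Proof.
move=> f; apply: fpsP => n /=.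
by rewrite big_ord_recl big1 => [|i _]; rewrite /= ?mul0r // mul1r addr0 subn0.
Qed.

Lemma fps_mulDl : left_distributive fps_mul +%R.
Proof.
move=> f g h; apply: fpsP => n /=; rewrite -big_split /=.
by apply: eq_bigr => i _; rewrite mulrDl.
Qed.

Lemma fps_oner_neq0 : fpsC 1 != 0.
Proof.
by apply/eqP => /(congr1 (fun f : {fps R} => f 0%N)) /eqP; rewrite /= oner_eq0.
Qed.

HB.instance Definition _ := GRing.Zmodule_isComNzRing.Build {fps R}
  fps_mulA fps_mulC fps_mul1 fps_mulDl fps_oner_neq0.

Lemma coef_fps1 n : (1 : {fps R}) n = (n == 0)%:R.
Proof. by case: n. Qed.

Lemma coef_fpsM f g n :
  (f * g) n = \sum_(i < n.+1) f i * g (n - i)%N.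
Proof. by []. Qed.

Lemma fpsC_is_zmod_morphism : zmod_morphism fpsC.
Proof. by move=> a b; apply: fpsP => -[|n] //; exact/esym/subr0. Qed.

Lemma fpsC_is_monoid_morphism : monoid_morphism fpsC.
Proof.
split=> // a b; apply: fpsP => -[|n]; rewrite coef_fpsM big_ord_recl /=.
  by rewrite big_ord0 addr0.
by rewrite mulr0 add0r big1 // => i _; rewrite mul0r.
Qed.

HB.instance Definition _ :=
  GRing.isZmodMorphism.Build R {fps R} fpsC fpsC_is_zmod_morphism.
HB.instance Definition _ :=
  GRing.isMonoidMorphism.Build R {fps R} fpsC fpsC_is_monoid_morphism.

End FpsRing.

Section FpsUnitRing.
Variable R : comUnitRingType.
Implicit Types f g : {fps R}.

Definition fps_unit : pred {fps R} := fun f => f 0%N \is a GRing.unit.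

(* The first [n.+1] coefficients of the inverse [g] of [f], from
   [f_0 g_(n.+1) = - \sum_(i <= n) f_(n.+1 - i) g_i]. *)
Fixpoint fps_inv_seq f (n : nat) : seq R :=
  if n is m.+1 then
    let s := fps_inv_seq f m in
    rcons s (- ((f 0%N)^-1 * \sum_(i < m.+1) f (m.+1 - i)%N * s`_i))
  else [:: (f 0%N)^-1].

(* As for every MathComp unit ring, the inverse of a non-unit is itself. *)
Definition fps_inv f : {fps R} :=
  if fps_unit f then FPS (fun n => (fps_inv_seq f n)`_n) else f.

Lemma size_fps_inv_seq f n : size (fps_inv_seq f n) = n.+1.
Proof. by elim: n => //= n IHn; rewrite size_rcons IHn. Qed.

Lemma nth_fps_inv_seq f n i : (i <= n)%N ->
  (fps_inv_seq f n)`_i = (fps_inv_seq f i)`_i.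
Proof.
elim: n => [|n IHn]; first by rewrite leqn0 => /eqP->.
rewrite leq_eqVlt => /predU1P[-> //|]; rewrite ltnS => le_in.
by rewrite /= nth_rcons size_fps_inv_seq ltnS le_in IHn.
Qed.

Lemma fps_mulVr : {in fps_unit, left_inverse 1 fps_inv *%R}.
Proof.
move=> f Uf; have {}Uf : fps_unit f := Uf; rewrite /fps_inv Uf; apply: fpsP => -[|n].
  by rewrite coef_fpsM big_ord_recl big_ord0 addr0 /= mulVr.
rewrite coef_fpsM coef_fps1 big_ord_recr /= subnn.
rewrite nth_rcons size_fps_inv_seq ltnn eqxx mulNr mulrC mulrA mulrV // mul1r.
apply/eqP; rewrite subr_eq0; apply/eqP; apply: eq_bigr => i _.
by rewrite mulrC (@nth_fps_inv_seq _ n) // -ltnS.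
Qed.

Lemma fps_unitP f g : g * f = 1 -> fps_unit f.
Proof.
move=> /(congr1 (fun h : {fps R} => h 0%N)).
rewrite coef_fpsM coef_fps1 big_ord_recl big_ord0 addr0 /= => gf1.
by apply/unitrPr; exists (g 0%N); rewrite mulrC.
Qed.

Lemma fps_inv_out : {in [predC fps_unit], fps_inv =1 id}.
Proof. by move=> f /negbTE Uf; have {}Uf : fps_unit f = false := Uf; rewrite /fps_inv Uf. Qed.

HB.instance Definition _ := GRing.ComNzRing_hasMulInverse.Build {fps R}
  fps_mulVr fps_unitP fps_inv_out.

Lemma fps_unitE f : (f \is a GRing.unit) = (f 0%N \is a GRing.unit).
Proof. by []. Qed.

End FpsUnitRing.

(* [K[[z, p]]], as [K[[p]][[z]]]: the coefficient of [z^i p^j] in [f]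
   is [f i j]. *)
Notation "{ 'fps2' K }" := {fps {fps K}} (at level 0, format "{ 'fps2'  K }").

Section Fps2.
Variable K : comUnitRingType.

Definition fps2z : {fps2 K} := fpsX _.
Definition fps2p : {fps2 K} := fpsC (fpsX K).
Definition fps2C (c : K) : {fps2 K} := fpsC (fpsC c).

(* [S] is the sum of the series [\sum_(n >= 0) F n] of formal power series:
   each coefficient of the partial sums is eventually that of [S]. *)
Definition is_fps2_sum (F : nat -> {fps2 K}) (S : {fps2 K}) : Prop :=
  forall i j : nat, exists N : nat, forall M : nat, (N <= M)%N ->
    (\sum_(n < M) F n) i j = S i j.

Lemma is_fps2_sum_uniq F S S' :
  is_fps2_sum F S -> is_fps2_sum F S' -> S = S'.
Proof.
move=> FS FS'; apply: fpsP => i; apply: fpsP => j.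
have [N /(_ (maxn N _)) NE] := FS i j; have [N' N'E] := FS' i j.
by rewrite -(NE N' (leq_maxl _ _)) N'E // leq_maxr.
Qed.

End Fps2.

Arguments fps2z {K}.
Arguments fps2p {K}.

Definition qpoch (R : comNzRingType) (a q : R) (n : nat) : R :=
  \prod_(i < n) (1 - a * q ^+ i).

(* [(u, e)] stands for the word whose [i]-th letter has absolute value [u i]
   (shifted by one, as ['I_n] starts at [0]) and is negative iff [e i]. *)
Definition signed_perm (n : nat) : Type := ('S_n * {ffun 'I_n -> bool})%type.
HB.instance Definition _ n := Finite.on (signed_perm n).

Definition word (n : nat) (w : signed_perm n) : seq int :=
  [seq (-1) ^+ (w.2 i) * (w.1 i).+1%:Z | i <- enum 'I_n].

Definition is_signed_word (n : nat) (v : seq int) : bool :=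
  perm_eq [seq `|x|%N | x <- v] (iota 1 n).

Lemma size_word n (w : signed_perm n) : size (word w) = n.
Proof. by rewrite size_map size_enum_ord. Qed.

Lemma nth_word n (w : signed_perm n) (i : 'I_n) :
  (word w)`_i = (-1) ^+ (w.2 i) * (w.1 i).+1%:Z.
Proof. by rewrite (nth_map i) ?size_enum_ord // nth_ord_enum. Qed.

Lemma absz_sign_letter (b : bool) (k : nat) : `|((-1) ^+ b * k%:Z : int)%R|%N = k.
Proof. by rewrite abszMsign. Qed.

Lemma sign_letter_lt0 (b : bool) (k : nat) :
  ((-1) ^+ b * k.+1%:Z < 0 :> int) = b.
Proof. by case: b. Qed.

Lemma word_inj n : injective (@word n).
Proof.
move=> w w' eq_ww'.
have E i : (-1) ^+ (w.2 i) * (w.1 i).+1%:Z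
             = (-1) ^+ (w'.2 i) * (w'.1 i).+1%:Z :> int.
  by rewrite -!nth_word eq_ww'.
case: w w' E {eq_ww'} => [u e] [u' e'] /= E; congr (_, _).
  apply/permP => i; apply/val_inj/succn_inj.
  by have /(congr1 absz) := E i; rewrite !absz_sign_letter.
apply/ffunP => i; rewrite -(sign_letter_lt0 (e i) (u i)) E.
exact: sign_letter_lt0.
Qed.

(* Hence [word] is a bijection from [signed_perm n] to the set [B_n] of words
   [v_1 ... v_n] such that [|v_1| ... |v_n|] is a permutation of [1 ... n]. *)
Lemma is_signed_wordP n (v : seq int) :
  reflect (exists w : signed_perm n, word w = v) (is_signed_word n v).
Proof.
apply: (iffP idP) => [vP | [w <-]]; last first.
  rewrite /is_signed_word /word -map_comp.
  rewrite (eq_map (g := fun i => (w.1 i).+1)); last first.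
    by move=> i /=; rewrite absz_sign_letter.
  apply: uniq_perm; rewrite ?iota_uniq //.
    rewrite map_inj_uniq ?enum_uniq // => i j [] /val_inj; exact: perm_inj.
  move=> k; rewrite mem_iota add1n ltnS; apply/mapP/andP => [[i _ ->] // |].
  case: k => [[] // | k [_ lekn]]; exists ((w.1^-1)%g (Ordinal lekn)).
    by rewrite mem_enum.
  by rewrite permKV.
have size_v : size v = n by have /perm_size := vP; rewrite size_map size_iota.
have abs_v (i : 'I_n) : (0 < `|(v`_i)%R|%N <= n)%N.
  have : `|(v`_i)%R|%N \in [seq `|x|%N | x <- v] by rewrite map_f // mem_nth ?size_v.
  by rewrite (perm_mem vP) mem_iota add1n ltnS.
have lt_v (i : 'I_n) : (`|(v`_i)%R|%N.-1 < n)%N.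
  by have /andP[/prednK->] := abs_v i.
pose f i := Ordinal (lt_v i).
have f_inj : injective f.
  move=> i j [] eqf; apply: val_inj => /=.
  have /andP[/prednK vi _] := abs_v i; have /andP[/prednK vj _] := abs_v j.
  have eqv : `|(v`_i)%R|%N = `|(v`_j)%R|%N by rewrite -vi -vj eqf.
  have uv : uniq [seq `|x|%N | x <- v] by rewrite (perm_uniq vP) iota_uniq.
  apply/eqP; rewrite -(nth_uniq 0%N _ _ uv) ?size_map ?size_v //.
  by rewrite !(nth_map 0) ?size_v // eqv.
exists (perm f_inj, [ffun i : 'I_n => v`_i < 0]).
apply: (@eq_from_nth _ 0); rewrite size_word ?size_v // => i lt_in.
rewrite (nth_word _ (Ordinal lt_in)) /= ffunE permE /=.
have /andP[/prednK-> _] := abs_v (Ordinal lt_in).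
exact/esym/intEsign.
Qed.

(* Positions in words start at [1]. *)
Definition letter (v : seq int) (i : nat) : int := nth 0 v i.-1.

Definition DES (v : seq int) : seq nat :=
  [seq i <- index_iota 1 (size v) | letter v i > letter v i.+1].
Definition des (v : seq int) : nat := size (DES v).
Definition maj (v : seq int) : nat := \sum_(i <- DES v) i.
Definition exc (v : seq int) : nat :=
  count (fun i => letter v i > i%:Z) (index_iota 1 (size v).+1).
Definition neg (v : seq int) : nat :=
  count (fun i => letter v i < 0) (index_iota 1 (size v).+1).
Definition fixp (v : seq int) : nat :=
  count (fun i => letter v i == i%:Z) (index_iota 1 (size v).+1).

(* [letter [::] 1 = 0], so that [desB [::] = 0]. *)
Definition desB (v : seq int) : nat := (des v + (letter v 1 < 0)%R)%N.
Definition fmaj (v : seq int) : nat := (2 * maj v + neg v)%N.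
Definition fexc (v : seq int) : nat := (2 * exc v + neg v)%N.

(* Main.v *)
From HB Require Import structures.
Require Import Defs.
From mathcomp Require Import all_boot all_order all_algebra all_fingroup.
From mathcomp Require Import boolp.
From mathcomp Require Import zify ring.

Set Implicit Arguments.
Unset Strict Implicit.
Unset Printing Implicit Defensive.

Import Order.TTheory GRing.Theory Num.Theory.
Local Open Scope ring_scope.

(* Fix [k] and write [N] for the coefficient of [p^k z^n] on the left.  By the
   theory of P-partitions, [N] is a weighted sum over the pairs of a signed
   permutation [w] and a weakly decreasing sequence [e] with values in
   [0 .. 2 k], where [e_i] is odd iff [w_i] is negative and [w] increases on the
   blocks of [e]; [e] contributes the weight [q^(sum e)].  Moving [e_i] to the
   position [|w_i|] turns these pairs into arbitrary words of length [n] over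
   [0 .. 2 k].  For an even letter [v], the occurrences that come from fixed points (excedances) are
   those preceded by exactly (more than) [N_v] letters different from [v],
   where [N_v] is the number of letters larger than [v].

   The words are summed by adding letters one at a time, from the largest value
   down, with the smaller letters merged into a blank: the words with [m] blanks
   have generating function [g * L^m], where [g] and [L] obey a first order
   recursion which the claimed product formula solves.  In words the letter of
   value [e] is encoded by [2 k - e], so that the letters come in the order
   0, 1, 2, ... *)

(** * Power series in one variable *)

Section FpsValuation.
Variable K : comUnitRingType.
Implicit Types (f g : {fps K}) (c : K).

Definition vanish (k : nat) f := forall i, (i < k)%N -> f i = 0.

Lemma vanish_mul a b f g : vanish a f -> vanish b g -> vanish (a + b) (f * g).
Proof.
move=> fa gb i lt_i; rewrite coef_fpsM big1 // => j _.
case: (ltnP j a) => [/fa-> | le_aj]; first by rewrite mul0r.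
by rewrite gb ?mulr0 //; have := ltn_ord j; lia.
Qed.

Lemma vanish_mulr a f g : vanish a f -> vanish a (f * g).
Proof. by move=> fa; rewrite -[a]addn0; apply: vanish_mul. Qed.

Lemma vanish_mull a f g : vanish a g -> vanish a (f * g).
Proof. by rewrite mulrC; apply: vanish_mulr. Qed.

Lemma vanish_exp f k : vanish 1 f -> vanish k (f ^+ k).
Proof. by move=> f1; elim: k => // k IHk; rewrite exprS -add1n; apply: vanish_mul. Qed.

Lemma coef_fpsMn f n i : (f *+ n) i = f i *+ n.
Proof. by elim: n => // n IHn; rewrite !mulrS coef_fpsD IHn. Qed.

Lemma coef_fpsCM c f n : (fpsC c * f) n = c * f n.
Proof.
rewrite coef_fpsM big_ord_recl subn0 big1 ?addr0 // => i _.
by rewrite mul0r.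
Qed.

Lemma coef_fpsXM f n : (fpsX K * f) n = if n is n'.+1 then f n' else 0.
Proof.
rewrite coef_fpsM; case: n => [|n]; first by rewrite big_ord1 mul0r.
rewrite !big_ord_recl big1 ?addr0 /= ?mul0r ?add0r ?mul1r ?subSS ?subn0 //.
by move=> i _; rewrite mul0r.
Qed.

Lemma coef_fpsXnM p f n : (fpsX K ^+ p * f) n = if (p <= n)%N then f (n - p)%N else 0.
Proof.
elim: p n => [|p IHp] n; first by rewrite mul1r subn0.
by rewrite exprS -mulrA coef_fpsXM; case: n => // n; rewrite IHp.
Qed.

Lemma vanishX : vanish 1 (fpsX K). Proof. by case. Qed.

Definition lin c : {fps K} := fpsC c * fpsX K.

Lemma vanish_lin c : vanish 1 (lin c).
Proof. exact/vanish_mull/vanishX. Qed.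

Lemma lin_mul c d : lin (c * d) = fpsC c * lin d.
Proof. by rewrite /lin rmorphM mulrA. Qed.

Definition geo c : {fps K} := FPS (fun n => c ^+ n).

Lemma geoE c : geo c * (1 - lin c) = 1.
Proof.
rewrite /lin; apply: fpsP => n; rewrite mulrC mulrBl mul1r coef_fpsD coef_fpsN -mulrA coef_fpsCM.
rewrite coef_fpsXM coef_fps1; case: n => [|n] /=; first by rewrite mulr0 subr0.
by rewrite exprS subrr.
Qed.

Lemma geoS c f n : (geo c * f) n.+1 = c * (geo c * f) n + f n.+1.
Proof.
have: geo c * f = fpsC c * (fpsX K * (geo c * f)) + f.
  apply/eqP; rewrite -subr_eq -{2}[f]mul1r -(geoE c) /lin.
  by apply/eqP; ring.
by move=> {1}->; rewrite coef_fpsD coef_fpsCM coef_fpsXM.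
Qed.

Lemma geo0 c f : (geo c * f) 0%N = f 0%N.
Proof. by rewrite coef_fpsM big_ord1 mul1r. Qed.

Lemma unit_fps1B f : vanish 1 f -> 1 - f \is a GRing.unit.
Proof.
by move=> f1; rewrite fps_unitE coef_fpsD coef_fpsN f1 // oppr0 addr0 unitr1.
Qed.

Lemma unit_lin c : 1 - lin c \is a GRing.unit.
Proof. exact/unit_fps1B/vanish_lin. Qed.

(** The negative binomial series is cut off at order [B] so that only finite sums occur; the
    coefficients below [B] do not see the error term. *)
Lemma eq_mod_sum_negbin (y : {fps K}) m B : vanish 1 y ->
  exists2 e : {fps K}, vanish B e &
    (\sum_(p < B) y ^+ p *+ 'C(m + p, p)) * (1 - y) ^+ m.+1 = 1 + e.
Proof.
move=> y1; elim: m B => [|m IHm] B.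
  exists (- y ^+ B); first by move=> i /(vanish_exp y1); rewrite coef_fpsN => ->; rewrite oppr0.
  rewrite expr1 mulrC; under eq_bigr do rewrite add0n binn mulr1n.
  by rewrite -opprB mulNr -subrX1 opprB.
(* By Pascal's rule, multiplication by [1 - y] lowers [m] by one up to a boundary term. The factor
   [0 < B] removes that term for the empty sum, where [B.-1] would be 0. *)
have E : (\sum_(p < B) y ^+ p *+ 'C(m.+1 + p, p)) * (1 - y)
   = \sum_(p < B) y ^+ p *+ 'C(m + p, p) - y * y ^+ B.-1 *+ 'C(m.+1 + B.-1, B.-1) *+ (0 < B).
  elim: B => [|B IHB]; first by rewrite !big_ord0 mul0r subr0.
  rewrite !big_ord_recr /= mulrDl IHB mulr1n.
  case: B {IHB} => [|B] /=; first by rewrite !big_ord0 !addn0 !bin0 !expr0 !mulr1n; ring.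
  have -> : 'C(m.+1 + B.+1, B.+1) = ('C(m + B.+1, B.+1) + 'C(m.+1 + B, B))%N.
    by rewrite addSn binS addnS addSn.
  by rewrite mulrnDr exprS; ring.
have [e eB eE] := IHm B.
rewrite [(1 - y) ^+ m.+2]exprS mulrA E mulrBl eE.
exists (e - y * y ^+ B.-1 *+ 'C(m.+1 + B.-1, B.-1) *+ (0 < B) * (1 - y) ^+ m.+1); last by ring.
move=> i iB; rewrite coef_fpsD eB // coef_fpsN add0r -exprS prednK; last by lia.
rewrite (vanish_mulr (a := B)) ?oppr0 // => k kB.
by rewrite !coef_fpsMn vanish_exp ?mul0rn.
Qed.

End FpsValuation.

(** * Words and the elimination of letters *)

Fixpoint words (k n : nat) : seq (seq nat) :=
  if n is n'.+1 then [seq v :: w | v <- iota 0 k, w <- words k n'] else [:: [::]].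

Lemma big_wordsS (V : nmodType) k n (F : seq nat -> V) :
  \sum_(w <- words k n.+1) F w = \sum_(0 <= v < k) \sum_(w <- words k n) F (v :: w).
Proof. by rewrite /= big_allpairs_dep /index_iota subn0. Qed.

Lemma big_words_cat (V : nmodType) k m n (F : seq nat -> V) :
  \sum_(w <- words k (m + n)) F w
    = \sum_(A <- words k m) \sum_(B <- words k n) F (A ++ B).
Proof.
elim: m F => [|m IHm] F; first by rewrite big_seq1.
by rewrite addSn !big_wordsS; apply: eq_bigr => v _; rewrite IHm.
Qed.

Lemma mem_words k n w : (w \in words k n) = (size w == n) && all (gtn k) w.
Proof.
elim: n w => [|n IHn] [|v w] //=.
  by apply/idP; case/allpairsPdep => [? [? []]].
rewrite eqSS andbCA -IHn; apply/allpairsPdep/andP => [[v' [w' [vk wn [-> ->]]]]|[vk wn]].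
  by move: vk; rewrite mem_iota.
by exists v, w; rewrite mem_iota.
Qed.

Lemma words_uniq k n : uniq (words k n).
Proof.
elim: n => //= n IHn; apply: allpairs_uniq => //; first exact: iota_uniq.
by move=> [a b] [a' b'] _ _ [-> ->].
Qed.

Lemma sum_pascal (V : nmodType) n (F : nat -> V) :
  \sum_(i < n.+2) F i *+ 'C(n.+1, i)
    = \sum_(i < n.+1) F i *+ 'C(n, i) + \sum_(i < n.+1) F i.+1 *+ 'C(n, i).
Proof.
rewrite big_ord_recl bin0.
under eq_bigr do rewrite /= /bump /= add1n binS mulrnDr.
rewrite big_split /= addrA; congr (_ + _).
rewrite [in LHS]big_ord_recr /= bin_small // mulr0n addr0.
by rewrite [in RHS]big_ord_recl bin0.
Qed.

(** The letters below [j] form an arbitrary word of some length [D], and their places among the [n]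
    positions can be chosen in ['C(n, D)] ways, the rest being filled with [j]. *)
Lemma sum_words_filter (V : nmodType) j n (Phi : seq nat -> V) :
  \sum_(B <- words j.+1 n) Phi (filter (gtn j) B)
    = \sum_(D < n.+1) (\sum_(C <- words j D) Phi C) *+ 'C(n, D).
Proof.
elim: n Phi => [|n IHn] Phi; first by rewrite big_ord1 bin0 mulr1n !big_seq1.
rewrite (sum_pascal _ (fun D => \sum_(C <- words j D) Phi C)) big_wordsS big_nat_recr //=.
rewrite ltnn IHn addrC; congr (_ + _).
under [in RHS]eq_bigr do rewrite big_wordsS -sumrMnl.
rewrite [RHS]exchange_big /= big_nat [RHS]big_nat; apply: eq_bigr => v /andP[_ vj].
by rewrite vj (IHn (fun w => Phi (v :: w))).
Qed.

(** Once [j] and [j.+1] are merged, the [p] places that held [j] can be any [p] of the places of the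
    merged letter. *)
Lemma sum_words_merge (V : nmodType) j n (Phi : seq nat -> nat -> V) :
  \sum_(A <- words j.+2 n) Phi (map (minn j) A) (count_mem j A)
    = \sum_(A <- words j.+1 n)
        \sum_(p < (count_mem j A).+1) Phi A p *+ 'C(count_mem j A, p).
Proof.
elim: n Phi => [|n IHn] Phi.
  by rewrite !big_seq1 big_ord1 bin0 mulr1n.
rewrite !big_wordsS !big_nat_recr //= -addrA; congr (_ + _).
  rewrite big_nat [in RHS]big_nat; apply: eq_bigr => v /andP[_ vj].
  have -> : minn j v = v by lia.
  have -> /= : v == j = false by lia.
  exact: (IHn (fun A p => Phi (v :: A) p)).
rewrite eqxx minnn (_ : minn j j.+1 = j); last by lia.
rewrite (_ : j.+1 == j = false); last by lia.
rewrite (IHn (fun A p => Phi (j :: A) p.+1)) (IHn (fun A p => Phi (j :: A) p)) -big_split.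
by apply: eq_bigr => A _ /=; rewrite addrC -(sum_pascal _ (Phi (j :: A))).
Qed.

Section WordWeight.
Variable K : comUnitRingType.

(* An occurrence of [v] preceded by [g] letters different from [v]
   has weight [om g]. *)
Fixpoint occw (v : nat) (om : nat -> K) (w : seq nat) : K :=
  if w is c :: w' then
    if c == v then om 0%N * occw v om w' else occw v (om \o S) w'
  else 1.

Lemma occw_const v om w x :
  (forall g, (g < size w)%N -> om g = x) -> occw v om w = x ^+ count_mem v w.
Proof.
elim: w om => //= c w IHw om omx; case: eqP => _.
  by rewrite omx // exprS IHw // => g gw; apply: omx; lia.
by rewrite IHw // => g gw; apply: omx.
Qed.

Lemma eq_occw v om om' w : om =1 om' -> occw v om w = occw v om' w.
Proof. by move=> /funext->. Qed.

Lemma occw_cat v om w1 w2 :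
  occw v om (w1 ++ w2)
    = occw v om w1 * occw v (fun g => om (g + count (predC1 v) w1)%N) w2.
Proof.
elim: w1 om => [|c w1 IHw] om /=.
  by rewrite mul1r; apply: eq_occw => g; rewrite addn0.
case: eqP => _ /=; rewrite IHw ?mulrA //; congr (_ * _).
by apply: eq_occw => g /=; rewrite add1n addnS.
Qed.

Lemma occw_merge v j om w : (v < j)%N -> occw v om (map (minn j) w) = occw v om w.
Proof.
move=> vj; elim: w om => //= c w IHw om; rewrite !IHw.
by rewrite (_ : (minn j c == v) = (c == v)) //; lia.
Qed.

(** The coefficient of degree [d] is the complete homogeneous symmetric polynomial of degree [d] in
    [om 0], ..., [om L]: it distributes [d] equal letters over the [L.+1] gaps around [L] others. *)
Definition hsum (om : nat -> K) L : {fps K} := \prod_(i < L.+1) geo (om i).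

Lemma hsum_n0 om L : hsum om L 0%N = 1.
Proof.
rewrite /hsum; elim/big_rec: _ => // i f _ f1.
by rewrite geo0.
Qed.

(** Deleting the letters [j] leaves [L] letters, and the word is recovered from the number of
    deleted letters in each gap; one in gap [g] weighs [om g]. The induction splits off the first
    letter, which either lies in gap 0 or shifts all gaps by one. *)
Lemma sum_words_del j n om (Phi : seq nat -> K) :
  \sum_(B <- words j.+2 n) occw j om B * Phi (map (minn j) (filter (predC1 j) B))
    = \sum_(L < n.+1) hsum om L (n - L)%N * \sum_(B <- words j.+1 L) Phi B.
Proof.
elim: n om Phi => [|n IHn] om Phi.
  by rewrite big_ord1 !big_seq1 hsum_n0.
rewrite big_wordsS !big_nat_recr //= eqxx.
rewrite (_ : j.+1 == j = false) /=; last by lia.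
rewrite (_ : minn j j.+1 = j); last by lia.
have -> : \sum_(B <- words j.+2 n)
    om 0%N * occw j om B * Phi (map (minn j) (filter (predC1 j) B))
  = om 0%N * \sum_(L < n.+1) hsum om L (n - L)%N * \sum_(B <- words j.+1 L) Phi B.
  by rewrite -IHn mulr_sumr; apply: eq_bigr => B _; rewrite mulrA.
rewrite addrAC.
have -> : \sum_(0 <= i < j) \sum_(w <- words j.+2 n)
     (if i == j then om 0%N * occw j om w else occw j (om \o S) w) *
     Phi (map (minn j) (if i != j then i :: filter (predC1 j) w else filter (predC1 j) w))
   + \sum_(w <- words j.+2 n)
      occw j (om \o S) w * Phi (j :: map (minn j) (filter (predC1 j) w))
   = \sum_(0 <= i < j.+1) \sum_(w <- words j.+2 n)
      occw j (om \o S) w * Phi (i :: map (minn j) (filter (predC1 j) w)).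
  rewrite big_nat_recr //=; congr (_ + _).
  rewrite !big_nat; apply: eq_bigr => i /andP[_ ij].
  have -> /= : i == j = false by lia.
  by have -> : minn j i = i by lia.
have -> : \sum_(0 <= i < j.+1) \sum_(w <- words j.+2 n)
      occw j (om \o S) w * Phi (i :: map (minn j) (filter (predC1 j) w))
   = \sum_(L < n.+1) hsum (om \o S) L (n - L)%N * \sum_(B <- words j.+1 L.+1) Phi B.
  transitivity (\sum_(0 <= i < j.+1) \sum_(L < n.+1)
      hsum (om \o S) L (n - L)%N * \sum_(B <- words j.+1 L) Phi (i :: B)).
    by apply: eq_bigr => i _; rewrite (IHn _ (fun B => Phi (i :: B))).
  by rewrite exchange_big; apply: eq_bigr => L _; rewrite -mulr_sumr -big_wordsS.
(* The term [L = 0] has gap 0 only. In the others gap 0 is split off, and [geoS] distinguishes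
   whether it is empty or contains a [j]. *)
rewrite [in RHS]big_ord_recl /= subn0.
have -> : hsum om 0 n.+1 = om 0%N * hsum om 0 n.
  by rewrite /hsum big_ord1 -[geo _]mulr1 geoS coef_fps1 addr0.
have -> : \sum_(i < n.+1) hsum om (bump 0 i) (n.+1 - bump 0 i)%N
      * \sum_(B <- words j.+1 (bump 0 i)) Phi B
  = \sum_(i < n.+1) hsum (om \o S) i (n - i)%N * \sum_(B <- words j.+1 i.+1) Phi B
  + om 0%N * \sum_(i < n) hsum om i.+1 (n - i.+1)%N * \sum_(B <- words j.+1 i.+1) Phi B.
  rewrite mulr_sumr [in RHS]big_ord_recr [in LHS]big_ord_recr /= /bump /= !add1n.
  rewrite !subSS !subnn !hsum_n0 addrAC -big_split; congr (_ + _) => /=.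
  apply: eq_bigr => i _; rewrite add1n subSS mulrA -mulrDl; congr (_ * _).
  have -> : hsum om i.+1 = geo (om 0%N) * hsum (om \o S) i.
    by rewrite /hsum big_ord_recl.
  have -> : (n - i = (n - i.+1).+1)%N by have := ltn_ord i; lia.
  by rewrite geoS addrC.
rewrite addrCA; congr (_ + _).
by rewrite big_ord_recl /= mulrDr subn0 mulrA.
Qed.

(** As used in [letw], for an even letter the three cases are, in order: neither fixed point nor
    excedance, fixed point, excedance. *)
Definition gapw (x rho tau : K) (N g : nat) : K :=
  if (g < N)%N then x else if g == N then rho else tau.

Lemma hsum_gapw x rho tau p m :
  hsum (gapw x rho tau p) (m + p) = geo x ^+ p * geo rho * geo tau ^+ m.
Proof.
rewrite /hsum addnC -addnS big_split_ord big_ord_recl /= mulrA; congr (_ * _ * _).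
- rewrite -[in RHS](card_ord p) -prodr_const; apply: eq_bigr => i _.
  by rewrite /gapw ltn_ord.
- by rewrite /gapw addn0 ltnn eqxx.
rewrite -[in RHS](card_ord m) -prodr_const; apply: eq_bigr => i _.
by rewrite /gapw /= /bump /= add1n !ifF //; apply/negbTE; lia.
Qed.

End WordWeight.

(** * One elimination step on the level of coefficients *)

Section Elimination.
Variables (K : comUnitRingType) (x rho tau : nat -> K).

Definition letw v w :=
  occw v (gapw (x v) (rho v) (tau v) (count (gtn v) w)) w.

(** Letters from [j] on act as blanks: they weigh 1 but still count as predecessors of other
    letters. *)
Definition wordw j w := \prod_(v < j) letw v w.

Lemma occw_gt (X r T : K) N s w v :
  ((0 < count_mem v w)%N -> (N < s)%N) ->
  occw v (fun g => gapw X r T N (g + s)) w = T ^+ count_mem v w.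
Proof.
case: (posnP (count_mem v w)) => [w0 _|pos /(_ isT) lt_Ns]; last first.
  by apply: occw_const => g _; rewrite /gapw !ifF //; apply/negbTE; lia.
rewrite w0; move: (fun g => _) => om; elim: w om w0 => //= c w IHw om.
by case: eqP => //= _ w0; rewrite (IHw (om \o S)).
Qed.

Lemma count_merge_gtn v j w : (v <= j)%N ->
  count (gtn v) (map (minn j) w) = count (gtn v) w.
Proof. by move=> vj; rewrite count_map; apply: eq_count => c /=; lia. Qed.

Lemma count_merge_mem v j w : (v < j)%N ->
  count_mem v (map (minn j) w) = count_mem v w.
Proof. by move=> vj; rewrite count_map; apply: eq_count => c /=; lia. Qed.

Lemma count_filter_gtn v j w : (v <= j)%N ->
  count (gtn v) (filter (gtn j) w) = count (gtn v) w.
Proof. by move=> vj; rewrite count_filter; apply: eq_count => c /=; lia. Qed.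

Lemma count_filter_mem v j w : (v < j)%N ->
  count_mem v (filter (gtn j) w) = count_mem v w.
Proof. by move=> vj; rewrite count_filter; apply: eq_count => c /=; lia. Qed.

Lemma count_gtn_lt v j w : (v < j)%N ->
  (count (gtn v) w + count_mem v w <= count (gtn j) w)%N.
Proof. by move=> vj; elim: w => //= c w; lia. Qed.

Lemma count_predC1 v (w : seq nat) : count (predC1 v) w = (size w - count_mem v w)%N.
Proof. by rewrite -(count_predC (pred1 v) w) addKn. Qed.

(* A letter [v < j] occurring in [B] lies to the right of its block in the
   sorted word, hence always has weight [tau v]. *)
Lemma wordw_cat j A B : size A = count (gtn j) (A ++ B) ->
  wordw j (A ++ B) = wordw j (map (minn j) A ++ filter (gtn j) B).
Proof.
move=> sizeA; apply: eq_bigr => -[v vj] _; rewrite /letw /=.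
rewrite !count_cat count_merge_gtn ?count_filter_gtn 1?ltnW // -count_cat.
rewrite !occw_cat occw_merge //; congr (_ * _).
have lt_v := count_gtn_lt (A ++ B) vj.
have lt_A : (count_mem v A + count (predC1 v) A = size A)%N by apply: count_predC.
have {}lt_v : (0 < count_mem v B)%N -> (count (gtn v) (A ++ B) < count (predC1 v) A)%N.
  by move: lt_v sizeA lt_A; rewrite !count_cat; lia.
rewrite !occw_gt ?count_filter_mem //.
by rewrite !count_predC1 count_merge_mem // size_map -count_predC1.
Qed.

(** [A] is as long as the number of letters below [j], so a [j] inside [A] has too few predecessors
    to leave the first case of [gapw]. A [j] in [B] is preceded by all letters of [A] other than
    [j]; counted within [B], the threshold therefore drops to the number of [j] in [A]. *)
Lemma letw_cat j A B : size A = count (gtn j) (A ++ B) ->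
  letw j (A ++ B) = x j ^+ count_mem j A
    * occw j (gapw (x j) (rho j) (tau j) (count_mem j A)) B.
Proof.
move=> sizeA; rewrite /letw -sizeA occw_cat (occw_const _ (x := x j)).
  congr (_ * _); apply: eq_occw => g; rewrite /gapw.
  have lt_A : (count_mem j A + count (predC1 j) A = size A)%N by apply: count_predC.
  rewrite (_ : (_ + _ < size A)%N = (g < count_mem j A)%N); last by lia.
  by rewrite (_ : (_ + _ == size A)%N = (g == count_mem j A)%N) //; lia.
by move=> g gA; rewrite /gapw gA.
Qed.

(** The word is cut after as many letters as it has nonblank ones. Then [D] blanks in the front part
    [A] force [D] nonblank letters in the rear part, which form the word [C]. *)
Definition fsum j N D : K :=
  \sum_(A <- words j.+1 N | count_mem j A == D)
    \sum_(C <- words j D) wordw j (A ++ C).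

Definition Fsum j m n : K :=
  \sum_(w <- words j.+1 (n + m) | count_mem j w == m) wordw j w.

Lemma words_size k n w : w \in words k n -> size w = n.
Proof. by rewrite mem_words => /andP[/eqP]. Qed.

Lemma words_count j n w : w \in words j.+1 n ->
  (count (gtn j) w + count_mem j w)%N = n.
Proof.
rewrite mem_words => /andP[/eqP<-].
by elim: w => //= c w IHw /andP[c_lt /IHw<-]; lia.
Qed.

Lemma words_merge j n w : w \in words j.+1 n -> map (minn j) w = w.
Proof.
rewrite mem_words => /andP[_].
by elim: w => //= c w IHw /andP[c_lt /IHw->]; congr (_ :: _); lia.
Qed.

(** By [wordw_cat] the weight ignores where blanks stand among the last [m] letters; if [D] letters
    there are not blank, there are ['C(m, D)] placements. *)
Lemma Fsum_fsum j m n : Fsum j m n = \sum_(D < m.+1) fsum j n D *+ 'C(m, D).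
Proof.
rewrite /Fsum big_mkcond big_words_cat.
transitivity (\sum_(A <- words j.+1 n) \sum_(D < m.+1 | count_mem j A == D)
   (\sum_(C <- words j D) wordw j (A ++ C)) *+ 'C(m, D)); last first.
  rewrite (exchange_big_dep predT) //=; apply: eq_bigr => D _.
  by rewrite /fsum -sumrMnl.
rewrite big_seq [RHS]big_seq; apply: eq_bigr => A An.
transitivity (\sum_(B <- words j.+1 m)
   if size (filter (gtn j) B) == count_mem j A then wordw j (A ++ filter (gtn j) B) else 0).
  rewrite big_seq [RHS]big_seq; apply: eq_bigr => B Bm.
  rewrite size_filter count_cat.
  have cA := words_count An; have cB := words_count Bm.
  rewrite (_ : (_ == m) = (count (gtn j) B == count_mem j A)); last by lia.
  case: eqP => // eqc; rewrite wordw_cat ?(words_merge An) //.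
  by rewrite count_cat eqc cA (words_size An).
rewrite (sum_words_filter _ _ (fun C => if size C == count_mem j A then wordw j (A ++ C) else 0)).
rewrite [RHS]big_mkcond; apply: eq_bigr => D _ /=; rewrite eq_sym.
case: eqP => [<-|neD].
  congr (_ *+ _); rewrite big_seq [RHS]big_seq; apply: eq_bigr => C Cn.
  by rewrite (words_size Cn) eqxx.
rewrite big_seq big1 ?mul0rn // => C Cn.
by rewrite (words_size Cn); case: eqP => // eD; case: neD.
Qed.

(** [N] is the number of letters below [j], and the word is cut after [N] letters. The front part
    has [p] letters [j] and [D] letters [j] or [j.+1], so the rear part has [D] letters below [j].
    The binomials choose the [p] letters among those [D], and the places of the [D] small letters
    among the [m + p] letters of the rear part other than [j]. The remaining [n - N - p] letters [j]
    lie in the rear part and are accounted for by [hsum]. *)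
Lemma Fsum_step j m n :
  Fsum j.+1 m n
    = \sum_(N < n.+1) \sum_(D < n.+1) \sum_(p < D.+1)
        fsum j N D * (x j ^+ p * (if (p <= n - N)%N then
          hsum (gapw (x j) (rho j) (tau j) p) (m + p) (n - N - p)%N else 0))
          *+ ('C(D, p) * 'C(m + p, D)).
Proof.
rewrite /Fsum.
transitivity (\sum_(N < n.+1) \sum_(w <- words j.+2 (n + m) | count_mem j.+1 w == m)
   if count (gtn j) w == N then wordw j.+1 w else 0).
  rewrite exchange_big [RHS]big_seq_cond [LHS]big_seq_cond /=.
  apply: eq_bigr => w /andP[wn /eqP wm].
  rewrite -big_mkcond /=.
  have lt_N : (count (gtn j) w < n.+1)%N.
    have {}wm : count_mem j.+1 w = m :> nat := wm.
    by have := words_count wn; have := count_gtn_lt w (ltnSn j); lia.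
  by rewrite (big_pred1 (Ordinal lt_N)) // => i; rewrite eq_sym.
apply: eq_bigr => -[N le_Nn] _ /=.
have -> : (n + m = N + (n - N + m))%N by lia.
rewrite big_mkcond big_words_cat.
pose hg p := hsum (gapw (x j) (rho j) (tau j) p).
(* The test [p <= n - N] excludes a negative number of letters [j] in the rear part, which truncated
   subtraction would turn into 0. *)
pose Phi (A : seq nat) p : K := x j ^+ p * ((if (p <= n - N)%N then
    hg p (m + p)%N (n - N - p)%N else 0) *+ 'C(m + p, count_mem j A))
    * \sum_(C <- words j (count_mem j A)) wordw j (A ++ C).
transitivity (\sum_(A <- words j.+2 N) Phi (map (minn j) A) (count_mem j A)).
  rewrite big_seq [RHS]big_seq; apply: eq_bigr => A An.
  set A' := map (minn j) A; set p := count_mem j A.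
  have cA' : (count (gtn j) A' + count_mem j A' = N)%N.
    have/(@words_count j) : A' \in words j.+1 N => [|//].
    rewrite mem_words size_map (words_size An) eqxx all_map.
    by apply/allP => c _ /=; lia.
  have cAA' : count (gtn j) A' = count (gtn j) A by apply: count_merge_gtn.
  have cA : (count (gtn j) A + p + count_mem j.+1 A = N)%N.
    have := words_count An; have := count_gtn_lt A (ltnSn j).
    have: count (gtn j.+1) A = (count (gtn j) A + p)%N.
      rewrite -count_predUI (@eq_count _ (predI _ _) pred0) ?count_pred0 ?addn0.
        by apply: eq_count => c /=; lia.
      by move=> c /=; lia.
    by lia.
  (* [Psi] receives the rear part with its letters [j] deleted. Given the lengths, its two
     conditions say that the whole word has [N] letters below [j] and [m] blanks. *)
  pose Psi B : K := if (count (gtn j) B == count_mem j A') && (size B == m + p)%N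
     then wordw j (A' ++ filter (gtn j) B) else 0.
  transitivity (\sum_(B <- words j.+2 (n - N + m))
     x j ^+ p * (occw j (gapw (x j) (rho j) (tau j) p) B
        * Psi (map (minn j) (filter (predC1 j) B)))).
    rewrite big_seq [RHS]big_seq; apply: eq_bigr => B Bm.
    have cB : (count (gtn j) B + count_mem j B + count_mem j.+1 B = n - N + m)%N.
      have := words_count Bm; have := count_gtn_lt B (ltnSn j).
      have: count (gtn j.+1) B = (count (gtn j) B + count_mem j B)%N.
        rewrite -count_predUI (@eq_count _ (predI _ _) pred0) ?count_pred0 ?addn0.
          by apply: eq_count => c /=; lia.
        by move=> c /=; lia.
      by lia.
    have cB' : count (gtn j) (map (minn j) (filter (predC1 j) B)) = count (gtn j) B.
      by rewrite count_merge_gtn // count_filter; apply: eq_count => c /=; lia.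
    have sB' : size (map (minn j) (filter (predC1 j) B)) = (n - N + m - count_mem j B)%N.
      by rewrite size_map size_filter count_predC1 (words_size Bm).
    rewrite /Psi cB' sB' !count_cat.
    have := letw_cat (j := j) (A := A) (B := B); rewrite count_cat (words_size An) => letwE.
    have := wordw_cat (j := j) (A := A) (B := B); rewrite count_cat (words_size An) => wordwE.
    rewrite -/p in letwE; rewrite -/A' in wordwE.
    move: cA cB cA' cAA' letwE wordwE; clear cB' sB'.
    set a1 := count (gtn j) A; set a2 := count_mem j.+1 A.
    set b1 := count (gtn j) B; set b2 := count_mem j.+1 B; set b3 := count_mem j B.
    set c1' := count (gtn j) A'; set c2' := count_mem j A'.
    move: a1 a2 b1 b2 b3 c1' c2' => a1 a2 b1 b2 b3 c1' c2' cA cB cA' cAA' letwE wordwE.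
    case: ifP => [c1|/negP c1]; last first.
      by case: ifP => [/andP[c2 c3]|_]; [case: c1; lia | rewrite !mulr0].
    case: ifP => [c2|/negP c2]; last first.
      by case: ifP => [/andP[c3 c4]|_]; [case: c2; lia | rewrite !mulr0].
    rewrite ifT; last by lia.
    have -> : wordw j.+1 (A ++ B) = wordw j (A ++ B) * letw j (A ++ B).
      exact: big_ord_recr.
    rewrite letwE; last by lia.
    rewrite wordwE; last by lia.
    rewrite [RHS]mulrA [RHS]mulrC; congr (wordw _ (_ ++ _) * _).
    (* The letters of [B] below [j] survive both the deletion of [j] and the merging. *)
    elim: (B) => //= c s ->; case: (ltngtP c j) => //= cj.
    - by rewrite (_ : minn j c = c) ?cj //; lia.
    - by rewrite (_ : minn j c = j) ?ltnn //; lia.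
  rewrite -mulr_sumr sum_words_del /Phi -mulrA; congr (_ * _).
  transitivity (\sum_(L < (n - N + m).+1 | nat_of_ord L == (m + p)%N)
     hg p L (n - N + m - L)%N * \sum_(B <- words j.+1 L) Psi B).
    rewrite [RHS]big_mkcond; apply: eq_bigr => L _; case: eqP => // neL.
    rewrite [X in _ * X]big_seq big1 ?mulr0 // => B Bn.
    by rewrite /Psi (words_size Bn) andbC; case: eqP.
  case: ifP => [le_p|gt_p]; last first.
    rewrite mul0rn mul0r big1 // => L /eqP LE.
    by have := ltn_ord L; lia.
  have lt_L : (m + p < (n - N + m).+1)%N by lia.
  rewrite (big_pred1 (Ordinal lt_L)) //= (_ : n - N + m - (m + p) = n - N - p)%N; last by lia.
  rewrite mulrnAl -mulrnAr; congr (_ * _).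
  transitivity (\sum_(B <- words j.+1 (m + p))
     if size (filter (gtn j) B) == count_mem j A' then wordw j (A' ++ filter (gtn j) B) else 0).
    rewrite big_seq [RHS]big_seq; apply: eq_bigr => B Bn.
    by rewrite /Psi (words_size Bn) eqxx andbT size_filter.
  rewrite (sum_words_filter _ _
    (fun C => if size C == count_mem j A' then wordw j (A' ++ C) else 0)).
  transitivity (\sum_(D < (m + p).+1 | nat_of_ord D == count_mem j A')
     (\sum_(C <- words j D) wordw j (A' ++ C)) *+ 'C(m + p, D)).
    rewrite [RHS]big_mkcond; apply: eq_bigr => D _; case: eqP => [eD|neD].
      congr (_ *+ _); rewrite big_seq [RHS]big_seq; apply: eq_bigr => C Cn.
      by rewrite (words_size Cn) eD eqxx.
    rewrite big_seq big1 ?mul0rn // => C Cn.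
    by rewrite (words_size Cn); case: eqP.
  case: (ltnP (count_mem j A') (m + p).+1) => [ltD|leD].
    by rewrite (big_pred1 (Ordinal ltD)).
  rewrite big1 => [|D /eqP DE]; first by rewrite bin_small // mulr0n.
  by have := ltn_ord D; lia.
rewrite sum_words_merge.
transitivity (\sum_(D < n.+1) \sum_(A <- words j.+1 N | count_mem j A == D)
   \sum_(p < D.+1) Phi A p *+ 'C(D, p)).
  rewrite (exchange_big_dep predT) //= big_seq [RHS]big_seq; apply: eq_bigr => A An.
  have lt_c : (count_mem j A < n.+1)%N by have := words_count An; lia.
  by rewrite (big_pred1 (Ordinal lt_c)) // => i /=; rewrite eq_sym.
apply: eq_bigr => D _; rewrite exchange_big /=; apply: eq_bigr => p _.
rewrite /fsum mulr_suml -sumrMnl; apply: eq_bigr => A /eqP cA.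
rewrite /Phi cA [in RHS]mulrC; case: ifP => _; last by rewrite mul0rn !mulr0 !mul0r !mul0rn.
by rewrite mulrnAr mulrnAl -mulrnA mulnC.
Qed.

End Elimination.

(** * The elimination step as a recursion for generating functions *)

Section EliminationSeries.
Variables (K : comUnitRingType) (x rho tau : nat -> K).

Definition elim_den (c : K) (L : {fps K}) := 1 - lin c * geo c * (L - 1).

(* [(elimG j).1] is the generating function of the words over [j] letters and
   [(elimG j).2] the factor contributed by each additional blank. *)
Fixpoint elimG (j : nat) : {fps K} * {fps K} :=
  if j is i.+1 then
    let gL := elimG i in
    let u := (elim_den (x i) gL.2)^-1 in
    (gL.1 * geo (rho i) * u, gL.2 * geo (tau i) * u)
  else (1, 1).

Lemma elimGS j : elimG j.+1 =
  let u := (elim_den (x j) (elimG j).2)^-1 in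
  ((elimG j).1 * geo (rho j) * u, (elimG j).2 * geo (tau j) * u).
Proof. by []. Qed.

Lemma elim_den0 c (L : {fps K}) : elim_den c L 0%N = 1.
Proof.
rewrite /elim_den coef_fpsD coef_fpsN !(vanish_mulr (a := 1)) ?oppr0 ?addr0 //.
exact/vanish_mulr/vanish_lin.
Qed.

Lemma elim_den_unit c L : elim_den c L \is a GRing.unit.
Proof. by rewrite fps_unitE elim_den0 unitr1. Qed.

Lemma coef_fps0M (f g : {fps K}) : (f * g) 0%N = f 0%N * g 0%N.
Proof. by rewrite coef_fpsM big_ord1. Qed.

Lemma coef_fps0V (f : {fps K}) : f 0%N = 1 -> f^-1 0%N = 1.
Proof.
move=> f0; have fU : f \is a GRing.unit by rewrite fps_unitE f0 unitr1.
by have := coef_fps0M f f^-1; rewrite mulrV // f0 mul1r.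
Qed.

Lemma elimG0 j : (elimG j).2 0%N = 1.
Proof.
elim: j => // j IHj; rewrite elimGS [(_, _).2]/= !coef_fps0M IHj coef_fps0V ?elim_den0 //.
by rewrite /geo /= expr0 !mulr1.
Qed.

Lemma coef_linXM c p (f : {fps K}) n :
  (lin c ^+ p * f) n = c ^+ p * (if (p <= n)%N then f (n - p)%N else 0).
Proof. by rewrite /lin exprMn -rmorphXn -mulrA coef_fpsCM coef_fpsXnM. Qed.

Lemma coef_eq_mod (e f g : {fps K}) n :
  vanish n.+1 e -> f = g + e -> f n = g n.
Proof. by move=> e0 ->; rewrite coef_fpsD e0 ?addr0. Qed.

(** Both sides are the trinomial coefficient (m + p)! / (p! d! (m - d)!). *)
Lemma bin_trinomial d m p : (d <= m)%N ->
  ('C(d + p, p) * 'C(m + p, d + p) = 'C(m + p, p) * 'C(m, d))%N.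
Proof.
move=> le_dm; apply/eqP; pose F := (p`! * (d`! * (m - d)`!))%N.
rewrite -(eqn_pmul2r (_ : 0 < F)%N) ?muln_gt0 ?fact_gt0 //; apply/eqP.
have b1 := bin_fact (leq_addl d p); have b2 := bin_fact le_dm.
have b3 := bin_fact (leq_addl m p).
have b4 : ('C(m + p, d + p) * ((d + p)`! * (m - d)`!) = (m + p)`!)%N.
  by rewrite -(subnDr p m d) bin_fact // leq_add2r.
rewrite !addnK in b1 b3.
transitivity ((m + p)`!)%N; first by rewrite -b4 -b1 /F; ring.
by rewrite -b3 -b2 /F; ring.
Qed.

(** With [D = d + p], [bin_trinomial] turns the sum over all [D] into the binomial expansion of
    [(h + 1) ^+ m]. The terms with [D > n] have order above [n] because [h] has no constant term;
    they form the error. *)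
Lemma sum_bin_mod (h a : {fps K}) m p n : vanish 1 h ->
  exists2 e : {fps K}, vanish n.+1 e &
   \sum_(D < n.+1) h ^+ D * a ^+ p *+ ('C(D, p) * 'C(m + p, D))
   = (a * h) ^+ p * (h + 1) ^+ m *+ 'C(m + p, p) + e.
Proof.
move=> h1; pose T D := h ^+ D * a ^+ p *+ ('C(D, p) * 'C(m + p, D)).
exists (- \sum_(n.+1 <= D < p + m.+1 + n.+1) T D).
  move=> i lt_in; rewrite coef_fpsN coef_fps_sum big_nat big1 ?oppr0 // => D /andP[le_nD _].
  rewrite coef_fpsMn (vanish_mulr _ (vanish_exp (k := D) h1)) ?mul0rn //.
  exact: leq_trans lt_in le_nD.
have E : \sum_(0 <= D < p + m.+1 + n.+1) T D = (a * h) ^+ p * (h + 1) ^+ m *+ 'C(m + p, p).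
  rewrite -addnA (big_cat_nat (n := p)) ?leq_addr //= big_nat big1 ?add0r; last first.
    by move=> D /andP[_ Dp]; rewrite /T bin_small.
  rewrite -{1}[p]add0n big_addn addKn (big_cat_nat (n := m.+1)) ?leq_addr //=.
  rewrite addrC big_nat big1 ?add0r; last first.
    by move=> D /andP[mD _]; rewrite /T ['C(m + p, _)]bin_small ?muln0 //; lia.
  rewrite exprD1n big_mkord mulr_sumr -sumrMnl; apply: eq_bigr => -[d d_m] _ /=.
  rewrite /T bin_trinomial // mulnC mulrnA mulrnAr; congr (_ *+ _ *+ _).
  by rewrite exprD exprMn; ring.
by rewrite -E (big_cat_nat (n := n.+1)) ?leq_addl //= addrK big_mkord.
Qed.

(** With [h = L - 1] the sum over [D] in [Fsum_step] is binomial, and the remaining sum over [p] is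
    a negative binomial series in [a * h]. Its value, the power [- m.+1] of [1 - a * h], supplies
    one denominator for [g] and one for each of the [m] factors [L]. *)
Lemma Fsum_elimG j m n :
  Fsum x rho tau j m n = ((elimG j).1 * (elimG j).2 ^+ m) n.
Proof.
elim: j m n => [|j IHj] m n.
  rewrite (_ : elimG 0 = (1, 1)) // [(_, _).1]/= [(_, _).2]/= expr1n mul1r coef_fps1 /Fsum.
  have -> : words 1 (n + m) = [:: nseq (n + m) 0%N].
    by elim: (n + m)%N => //= s ->.
  rewrite big_mkcond big_seq1 count_nseq mul1n /wordw big_ord0.
  rewrite (_ : (_ == m) = (n == 0%N)); last by lia.
  by case: (n == 0%N).
set g := (elimG j).1 in IHj *; set L := (elimG j).2 in IHj *.
pose h := L - 1.
have LE : L = h + 1 by rewrite subrK.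
have h1 : vanish 1 h.
  by case=> // _; rewrite coef_fpsD coef_fpsN elimG0 coef_fps1 subrr.
(* Binomial inversion of [Fsum_fsum]: [L ^+ D] expands in powers of [h], and strong induction on [D]
   isolates the top term. *)
have fE D N : fsum x rho tau j N D = (g * h ^+ D) N.
  elim: D {-2}D (leqnn D) N => [|b IHb] D leDb N.
    move: leDb; rewrite leqn0 => /eqP->; have := IHj 0%N N.
    by rewrite Fsum_fsum big_ord1 bin0 mulr1n.
  case: (ltnP D b.+1) => [ltD|geD]; first exact: IHb.
  have {leDb geD} -> : D = b.+1 by lia.
  have LX : L ^+ b.+1 = \sum_(i < b.+1) h ^+ i *+ 'C(b.+1, i) + h ^+ b.+1.
    by rewrite LE exprD1n big_ord_recr /= binn mulr1n.
  have := IHj b.+1 N; rewrite Fsum_fsum big_ord_recr binn mulr1n LX.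
  rewrite mulrDr coef_fpsD mulr_sumr coef_fps_sum.
  have -> : \sum_(i < b.+1) (g * (h ^+ i *+ 'C(b.+1, i))) N
          = \sum_(i < b.+1) fsum x rho tau j N i *+ 'C(b.+1, i).
    by apply: eq_bigr => i _; rewrite IHb ?mulrnAr ?coef_fpsMn // -ltnS.
  by move/addrI.
pose a := lin (x j) * geo (x j).
pose ET := geo (rho j) * geo (tau j) ^+ m.
rewrite Fsum_step.
transitivity ((\sum_(D < n.+1) \sum_(p < D.+1)
   h ^+ D * a ^+ p * (g * ET) *+ ('C(D, p) * 'C(m + p, D))) n).
  rewrite exchange_big coef_fps_sum /=; apply: eq_bigr => D _.
  rewrite exchange_big coef_fps_sum /=; apply: eq_bigr => p _.
  have -> : h ^+ D * a ^+ p * (g * ET)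
     = (g * h ^+ D) * (lin (x j) ^+ p * hsum (gapw (x j) (rho j) (tau j) p) (m + p)).
    by rewrite hsum_gapw /a /ET exprMn; ring.
  rewrite coef_fpsMn coef_fpsM -sumrMnl; apply: eq_bigr => N _.
  by rewrite fE coef_linXM.
transitivity ((\sum_(p < n.+1)
   (\sum_(D < n.+1) h ^+ D * a ^+ p *+ ('C(D, p) * 'C(m + p, D))) * (g * ET)) n).
  (* The range of [p] is extended to [n], which only adds terms with ['C(D, p) = 0]. *)
  rewrite (_ : \sum_(D < n.+1) _ = \sum_(D < n.+1) \sum_(p < n.+1)
     (h ^+ D * a ^+ p * (g * ET)) *+ ('C(D, p) * 'C(m + p, D))); last first.
    apply: eq_bigr => D _.
    rewrite -!(big_mkord predT
      (fun p => h ^+ D * a ^+ p * (g * ET) *+ ('C(D, p) * 'C(m + p, D)))).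
    rewrite [RHS](big_cat_nat (n := D.+1)) //=.
    rewrite [X in _ = _ + X]big_nat [X in _ = _ + X]big1 ?addr0 //.
    by move=> p /andP[ltDp _]; rewrite bin_small.
  rewrite exchange_big; congr (fps_coef _ n); apply: eq_bigr => p _ /=.
  by rewrite mulr_suml; apply: eq_bigr => D _; rewrite mulrnAl.
have a1 : vanish 1 (a * h) by exact: vanish_mull.
have key b : exists2 e : {fps K}, vanish n.+1 e &
   \sum_(p < b) (\sum_(D < n.+1) h ^+ D * a ^+ p *+ ('C(D, p) * 'C(m + p, D)))
   = (\sum_(p < b) (a * h) ^+ p *+ 'C(m + p, p)) * (h + 1) ^+ m + e.
  elim: b => [|b [e e0 eE]]; first by exists 0; rewrite ?big_ord0 ?mul0r ?addr0.
  have [e' e'0 e'E] := sum_bin_mod a m b n h1.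
  exists (e + e'); first by move=> i lt_i; rewrite coef_fpsD e0 ?e'0 ?addr0.
  by rewrite [LHS]big_ord_recr eE e'E [in RHS]big_ord_recr mulrDl mulrnAl addrACA.
have [e e0 eE] := key n.+1.
have [e' e'0 e'E] := eq_mod_sum_negbin m n.+1 a1.
have uU : (1 - a * h) ^+ m.+1 \is a GRing.unit by rewrite unitrX ?unit_fps1B.
have {}e'E : \sum_(p < n.+1) (a * h) ^+ p *+ 'C(m + p, p)
    = (1 - a * h) ^- m.+1 + e' * (1 - a * h) ^- m.+1.
  by apply: (mulIr uU); rewrite e'E mulrDl mulVr // mulrVK.
rewrite -mulr_suml eE e'E elimGS [(_, _).1]/= [(_, _).2]/=.
apply: (@coef_eq_mod (e' * ((1 - a * h) ^- m.+1 * (h + 1) ^+ m * (g * ET)) + e * (g * ET))).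
  by move=> i lt_i; rewrite coef_fpsD (vanish_mulr _ e'0) // (vanish_mulr _ e0) ?addr0.
rewrite -/g -/L /elim_den -/h -/a -LE exprMn exprMn exprVn /ET exprSr invrM ?unitrX ?unit_fps1B //.
ring.
Qed.

End EliminationSeries.

(** * Solution of the recursion by products *)

Section ClosedForm.
Variables (K : comUnitRingType) (q t r s : K) (k : nat).

(* The letter [a] stands for the value [2 * k - a], which belongs to negative
   entries of the signed permutation when it is odd. *)
Definition wx a : K := (if odd a then s * t else 1) * q ^+ (2 * k - a).
Definition wrho a : K := (if odd a then s * t else r) * q ^+ (2 * k - a).
Definition wtau a : K := (if odd a then s * t else t ^+ 2) * q ^+ (2 * k - a).

Lemma elim_den_lin c (L : {fps K}) : elim_den c L * (1 - lin c) = 1 - lin c * L.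
Proof.
transitivity (1 - lin c - lin c * (L - 1) * (geo c * (1 - lin c))).
  by rewrite /elim_den; ring.
by rewrite geoE; ring.
Qed.

Lemma elimG_rec (x rho tau : nat -> K) j :
  let G := elimG x rho tau in
  (G j.+1).1 * (1 - lin (rho j)) * (1 - lin (x j) * (G j).2)
    = (G j).1 * (1 - lin (x j)) /\
  (G j.+1).2 * (1 - lin (tau j)) * (1 - lin (x j) * (G j).2)
    = (G j).2 * (1 - lin (x j)).
Proof.
move=> G; rewrite /G elimGS [(_, _).1]/= [(_, _).2]/= -/G -elim_den_lin.
have U := mulVr (elim_den_unit (x j) (G j).2).
set u := elim_den _ _ in U *.
have aux g c y : g * geo c * u^-1 * (1 - lin c) * (u * y) = g * y.
  transitivity (g * y * (geo c * (1 - lin c)) * (u^-1 * u)); first by ring.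
  by rewrite geoE U !mulr1.
by rewrite !aux.
Qed.

Local Notation G := (elimG wx wrho wtau).
Local Notation X i := (lin (q ^+ (2 * (k - i)))).
Let a : {fps K} := fpsC (t ^+ 2 * q ^+ 2).
Let b : {fps K} := fpsC (s * q * t).
Let A i : {fps K} := \prod_(l < i) (1 - X l.+1).
Let B i : {fps K} := \prod_(l < i) (1 - a * X l.+1).
Let Rp i : {fps K} := \prod_(l < i) (1 - fpsC r * X l).
Let D i := (1 + b) * A i - (a + b) * B i.

(** The formulas describe the state after each even letter. An odd letter has equal [x], [rho] and
    [tau], so it only divides both components by [1 - b * x * L]; the next even letter brings in the
    new factors of [A], [B] and [Rp]. The first formula at [i = k] gives the closed form. *)
Lemma wordG_invariant i : (i <= k)%N ->
  (G (2 * i).+1).1 * Rp i.+1 * D i = (1 - a) * A i * B i /\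
  (G (2 * i).+1).2 * D i * (1 - fpsC (t ^+ 2) * X i) = (1 - a) * A i.
Proof.
elim: i => [|i IHi] le_ik.
  have [] := elimG_rec wx wrho wtau 0; rewrite muln0.
  rewrite (_ : G 0 = (1, 1)) // [(_, _).1]/= [(_, _).2]/=.
  have -> : wx 0 = q ^+ (2 * (k - 0)) by rewrite /wx /= mul1r !subn0.
  have -> : wrho 0 = r * q ^+ (2 * (k - 0)) by rewrite /wrho /= !subn0.
  have -> : wtau 0 = t ^+ 2 * q ^+ (2 * (k - 0)) by rewrite /wtau /= !subn0.
  rewrite !lin_mul mul1r mulr1; set x := X 0 => E1 E2.
  have {}E1 := mulIr (unit_lin _) E1; have {}E2 := mulIr (unit_lin _) E2.
  rewrite /D /A /B /Rp !big_ord0 big_ord1 -/x E1.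
  by split; [|rewrite mulrAC E2]; rewrite /=; ring.
have [] := IHi (ltnW le_ik); set g := (G _).1; set L := (G _).2 => I1 I2.
have [] := elimG_rec wx wrho wtau (2 * i).+1; rewrite -/g -/L.
set g1 := (G _).1; set L1 := (G _).2.
have [] := elimG_rec wx wrho wtau (2 * i).+2; rewrite -/g1 -/L1.
rewrite (_ : (2 * i).+3 = (2 * i.+1).+1); last by lia.
set g2 := (G _).1; set L2 := (G _).2.
set x := X i.+1.
(* Consecutive even letters differ by [q ^+ 2], so the factor [1 - fpsC (t ^+ 2) * X i] of the
   second formula is the new factor [1 - a * x] of [B]. *)
have q2 : X i = fpsC (q ^+ 2) * x.
  by rewrite -lin_mul -exprD; congr (lin (q ^+ _)); lia.
have odd0 : odd (2 * i) = false by rewrite oddM.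
have -> : lin (wx (2 * i).+2) = x.
  by rewrite /wx /= odd0 mul1r; congr (lin (q ^+ _)); lia.
have -> : lin (wrho (2 * i).+2) = fpsC r * x.
  by rewrite /wrho /= odd0 lin_mul; congr (_ * lin (q ^+ _)); lia.
have -> : lin (wtau (2 * i).+2) = fpsC (t ^+ 2) * x.
  by rewrite /wtau /= odd0 lin_mul; congr (_ * lin (q ^+ _)); lia.
have y1 : lin (s * t * q ^+ (2 * k - (2 * i).+1)) = b * x.
  rewrite -lin_mul (_ : (2 * k - (2 * i).+1 = (2 * (k - i.+1)).+1)%N); last by lia.
  by congr lin; rewrite exprS; ring.
have -> : lin (wx (2 * i).+1) = b * x by rewrite /wx /= odd0 y1.
have -> : lin (wrho (2 * i).+1) = b * x by rewrite /wrho /= odd0 y1.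
have -> : lin (wtau (2 * i).+1) = b * x by rewrite /wtau /= odd0 y1.
move=> E1 E2 F1 F2.
have bxU : 1 - b * x \is a GRing.unit by rewrite -y1 unit_lin.
have {}F1 : g1 * (1 - b * x * L) = g by apply: (mulIr bxU); rewrite -F1; ring.
have {}F2 : L1 * (1 - b * x * L) = L by apply: (mulIr bxU); rewrite -F2; ring.
have aE : fpsC (t ^+ 2) * (fpsC (q ^+ 2) * x) = a * x by rewrite mulrA -rmorphM.
move: I2; rewrite q2 aE => I2.
have AS : A i.+1 = A i * (1 - x) by exact: big_ord_recr.
have BS : B i.+1 = B i * (1 - a * x) by exact: big_ord_recr.
have RS : Rp i.+2 = Rp i.+1 * (1 - fpsC r * x) by exact: big_ord_recr.
(* By [F2] the two denominators multiply to [1 - (1 + b) * x * L], and [I2] then eliminates [L]. *)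
have DE : D i.+1 = D i * (1 - a * x) * ((1 - b * x * L) * (1 - x * L1)).
  transitivity (D i * (1 - a * x) * (1 - b * x * L - x * (L1 * (1 - b * x * L))));
    last by ring.
  rewrite F2.
  transitivity (D i * (1 - a * x) - (1 + b) * x * (L * D i * (1 - a * x))); last by ring.
  by rewrite I2 /D AS BS; ring.
split.
  rewrite DE AS BS RS.
  transitivity (g2 * (1 - fpsC r * x) * (1 - x * L1) * Rp i.+1 * D i
    * (1 - a * x) * (1 - b * x * L)); first by ring.
  rewrite E1.
  transitivity (g1 * (1 - b * x * L) * Rp i.+1 * D i * (1 - x) * (1 - a * x)); first by ring.
  by rewrite F1 I1; ring.
rewrite DE AS.
transitivity (L2 * (1 - fpsC (t ^+ 2) * x) * (1 - x * L1) * D i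
  * (1 - a * x) * (1 - b * x * L)); first by ring.
rewrite E2.
transitivity (L1 * (1 - b * x * L) * D i * (1 - a * x) * (1 - x)); first by ring.
by rewrite F2 I2; ring.
Qed.

Lemma qpoch_lin (c : {fps K}) n :
  qpoch (c * fpsX K) (fpsC (q ^+ 2)) n = \prod_(l < n) (1 - c * lin (q ^+ (2 * l))).
Proof.
apply: eq_bigr => l _; rewrite -rmorphXn -exprM /lin; congr (1 - _); ring.
Qed.

Hypothesis Uqt : 1 - t ^+ 2 * q ^+ 2 \is a GRing.unit.

(** The constant coefficient is (1 + sqt) - (t^2 q^2 + sqt) = 1 - t^2 q^2, invertible by [Uqt]. *)
Lemma closed_den_unit (z := fpsX K) (q2 := fpsC (q ^+ 2)) :
  qpoch (fpsC r * z) q2 k.+1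
    * ((1 + b) * qpoch z q2 k - (a + b) * qpoch (a * z) q2 k) \is a GRing.unit.
Proof.
have qpoch_coef0 (c : {fps K}) n : qpoch (c * z) q2 n 0%N = 1.
  rewrite qpoch_lin; elim/big_rec: _ => // l y _ y1.
  rewrite coef_fps0M y1 coef_fpsD coef_fpsN coef_fps0M vanish_lin //.
  by rewrite mulr0 oppr0 addr0 mulr1.
rewrite -[z in qpoch z q2 k]mul1r fps_unitE coef_fps0M coef_fpsD coef_fpsN !coef_fps0M.
rewrite !qpoch_coef0 mul1r !mulr1 !coef_fpsD /=.
by rewrite opprD addrACA subrr addr0.
Qed.

Lemma elimG_closed (z := fpsX K) (q2 := fpsC (q ^+ 2)) :
  (G (2 * k).+1).1
    = ((1 - a) * qpoch z q2 k * qpoch (a * z) q2 k)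
      / (qpoch (fpsC r * z) q2 k.+1
         * ((1 + b) * qpoch z q2 k - (a + b) * qpoch (a * z) q2 k)).
Proof.
have [E _] := wordG_invariant (leqnn k).
(* The exponents in [X] decrease with the index, whereas those in [qpoch] increase. *)
have revE (c : {fps K}) n :
    \prod_(l < n) (1 - c * lin (q ^+ (2 * (n - l.+1)))) = qpoch (c * z) q2 n.
  by rewrite qpoch_lin [RHS](reindex_inj rev_ord_inj).
have AE : A k = qpoch z q2 k.
  by rewrite -[z]mul1r -revE; apply: eq_bigr => l _; rewrite mul1r.
have BE : B k = qpoch (a * z) q2 k by rewrite -revE.
have RE : Rp k.+1 = qpoch (fpsC r * z) q2 k.+1.
  by rewrite -revE; apply: eq_bigr => l _; rewrite subSS.
by rewrite -AE -BE -E /D AE BE RE -mulrA mulrK // closed_den_unit.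
Qed.

End ClosedForm.

(** * Standardization and P-partitions *)

Section Standardization.

Lemma sum_ord_lt n (i : 'I_n) : (\sum_(l < n | l < i) 1)%N = i.
Proof. by rewrite -(big_ord_widen n (fun=> 1%N) (ltnW (ltn_ord i))) sum1_card card_ord. Qed.

Definition rank n (R : rel 'I_n) (j : 'I_n) : nat := #|[pred i | R i j]|.

(** In a sorted list an element stands at the position given by the number of its predecessors, and
    for a strict total order this rank is a bijection. *)
Lemma sorting_perm n (R : rel 'I_n) :
  irreflexive R -> transitive R -> (forall i j, i != j -> R i j || R j i) ->
  exists2 u : 'S_n, (forall i, rank R (u i) = i) &
    forall u' : 'S_n, (forall i j : 'I_n, (i < j)%N -> R (u' i) (u' j)) <-> u' = u.
Proof.
move=> Rirr Rtr Rtot.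
have rank_lt i j : R i j -> (rank R i < rank R j)%N.
  move=> Rij; apply/proper_card/properP; split.
    by apply/subsetP => l; rewrite !inE => /Rtr->.
  by exists i; rewrite !inE ?Rirr.
have rank_n j : (rank R j < n)%N.
  rewrite -[n in (_ < n)%N]card_ord; apply/proper_card/properP; split.
    exact/subsetP.
  by exists j; rewrite !inE ?Rirr.
have rank_inj : injective (fun j => Ordinal (rank_n j)).
  move=> i j [] eqr; apply/eqP/negPn/negP => /Rtot/orP[] /rank_lt; rewrite eqr ltnn //.
pose u := ((perm rank_inj)^-1)%g.
have ru i : rank R (u i) = i.
  by have /(congr1 val) := permKV (perm rank_inj) i; rewrite permE.
exists u => // u'; split=> [u'P | -> i j ltij].
  have R_u' i j : R (u' i) (u' j) = (i < j)%N.
    case: ltngtP => [/u'P//|/u'P Rji|/val_inj->]; last exact: Rirr.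
    by apply/negP => /(Rtr _ _ _ Rji); rewrite Rirr.
  apply/permP => j; apply: (@rank_inj (u' j) (u j)); apply: val_inj; rewrite /= ru.
  rewrite /rank -sum1_card (reindex_inj (@perm_inj _ u')) /=.
  by under eq_bigl do rewrite inE R_u'; rewrite sum_ord_lt.
have: u i != u j by rewrite (inj_eq perm_inj) -val_eqE; apply/negbT/ltn_eqF.
by case/Rtot/orP => // /rank_lt; rewrite !ru ltnNge ltnW.
Qed.

Lemma nth_map_enum_ord n (g : 'I_n -> nat) (i : 'I_n) :
  nth 0%N [seq g j | j <- enum 'I_n] i = g i.
Proof. by rewrite (nth_map i) ?size_enum_ord // nth_ord_enum. Qed.

Lemma sum_words_ffun (V : nmodType) k n (F : seq nat -> V) :
  \sum_(w <- words k n) F w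
    = \sum_(f : {ffun 'I_n -> 'I_k}) F [seq nat_of_ord (f i) | i <- enum 'I_n].
Proof.
pose h (f : {ffun 'I_n -> 'I_k}) := [seq nat_of_ord (f i) | i <- enum 'I_n].
rewrite -(big_map h predT F); apply/perm_big/uniq_perm.
- exact: words_uniq.
- rewrite map_inj_uniq ?index_enum_uniq // => f g eq_h; apply/ffunP => i.
  apply: val_inj; transitivity (nth 0%N (h f) i); first by rewrite nth_map_enum_ord.
  by rewrite eq_h nth_map_enum_ord.
move=> w; rewrite mem_words; apply/andP/mapP => [[/eqP size_w /allP w_lt]|[f _ ->]].
  have lt_w (i : 'I_n) : (nth 0%N w i < k)%N by apply/w_lt/mem_nth; rewrite size_w.
  exists [ffun i => Ordinal (lt_w i)]; first exact: mem_index_enum.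
  apply: (@eq_from_nth _ 0%N) => [|i]; first by rewrite size_w size_map size_enum_ord.
  rewrite size_w => lt_in.
  by rewrite (nth_map_enum_ord _ (Ordinal lt_in)) ffunE.
rewrite size_map size_enum_ord eqxx; split=> //.
by apply/allP => _ /mapP[i _ ->] /=.
Qed.

Lemma count_take_nth (P : pred nat) s j : (j <= size s)%N ->
  count P (take j s) = (\sum_(0 <= i < size s | (i < j)%N) P (nth 0%N s i))%N.
Proof.
move=> le_j; rewrite big_mkord -sum1_count (big_nth 0%N) size_takel // big_mkcond big_mkord.
rewrite (big_ord_widen (size s) (fun i => if P (nth 0 (take j s) i) then 1 else 0)%N) //.
by apply: eq_bigr => i ij; rewrite nth_take //; case: (P _).
Qed.

Lemma count_nth (P : pred nat) s :
  count P s = (\sum_(0 <= i < size s) P (nth 0 s i))%N.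
Proof.
rewrite -{1}[s]take_size count_take_nth // !big_mkord.
by apply: eq_bigl => i; rewrite ltn_ord.
Qed.

Lemma occw_prod (K : comUnitRingType) v (om : nat -> K) w :
  occw v om w = \prod_(0 <= j < size w | nth 0%N w j == v) om (count (predC1 v) (take j w)).
Proof.
elim: w om => [|c w IHw] om /=; first by rewrite big_geq.
rewrite big_mkcond big_mkord big_ord_recl /= !IHw !big_mkord -!big_mkcond /=.
case: eqP => _ //=; rewrite mul1r.
by apply: eq_bigr => j _; rewrite add1n.
Qed.

Variables (K : comUnitRingType) (q t r s : K) (k n : nat).

(** The order required of the pairs [(e_i, w_i)]: values decrease, and letters increase within a
    block of equal values. *)
Definition lexgt (a b : nat * int) : bool :=
  (b.1 < a.1)%N || (b.1 == a.1) && (a.2 < b.2)%R.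

Definition signed_letter (w : signed_perm n) (i : 'I_n) : int :=
  (-1) ^+ (w.2 i) * (w.1 i).+1%:Z.

Definition compatible (w : signed_perm n) (e : {ffun 'I_n -> 'I_(2 * k).+1}) : bool :=
  [forall i, odd (e i) == w.2 i] &&
  [forall i : 'I_n, forall j : 'I_n, (i < j)%N ==>
    lexgt (nat_of_ord (e i), signed_letter w i) (nat_of_ord (e j), signed_letter w j)].

Definition entry_weight (w : signed_perm n) (i : 'I_n) : K :=
  if w.2 i then s * t
  else if (i < w.1 i)%N then t ^+ 2 else if w.1 i == i then r else 1.

Lemma lexgt_irr : irreflexive lexgt.
Proof. by move=> a; rewrite /lexgt ltnn eqxx ltxx. Qed.

Lemma lexgt_trans : transitive lexgt.
Proof.
move=> b a c; rewrite /lexgt.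
case/orP => [ltba|/andP[/eqP-> ab]]; case/orP => [ltcb|/andP[/eqP-> bc]].
- by rewrite (ltn_trans ltcb ltba).
- by rewrite ltba.
- by rewrite ltcb.
by rewrite eqxx (lt_trans ab bc) orbT.
Qed.

Section Word.
Variable f : {ffun 'I_n -> 'I_(2 * k).+1}.

(** [f j] is the value of [e] at the letter of absolute value [j.+1], whose sign is dictated by
    parity. Sorting the keys recovers the signed permutation. *)
Let key (j : 'I_n) : nat * int := (nat_of_ord (f j), (-1) ^+ odd (f j) * j.+1%:Z).
Let R (i j : 'I_n) := lexgt (key i) (key j).

(** An even value belongs to positive letters, so ties are broken by increasing index. *)
Lemma rank_key j : ~~ odd (f j) ->
  rank R j = (\sum_(i < n) (f j < f i) + \sum_(i < n | i < j) (f i == f j))%N.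
Proof.
move=> ev; rewrite /rank -sum1_card [X in (_ + X)%N]big_mkcond -big_split big_mkcond /=.
apply: eq_bigr => i _; rewrite inE /R /lexgt /key /= -val_eqE /= [(f j == f i :> nat)]eq_sym.
case: eqP => [->|_]; last by case: (_ < _)%N; case: (i < j)%N.
rewrite ltnn (negbTE ev) !mul1r /=.
by rewrite ltz_nat ltnS; case: (i < j)%N.
Qed.

(** Let [N] be the number of larger values, and [c] and [e] the numbers of earlier positions with a
    different and with the same value. Then [j = c + e] and, for an even value, the rank is [N + e];
    comparing the rank with [j] is thus the test of [c] against [N] in [gapw]. *)
Lemma wordw_word :
  wordw (wx q t s k) (wrho q t r s k) (wtau q t s k) (2 * k).+1
    [seq (2 * k - f i)%N | i <- enum 'I_n]
  = \prod_j (q ^+ f j * (if odd (f j) then s * t else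
      if (rank R j < j)%N then t ^+ 2 else if rank R j == j then r else 1)).
Proof.
set w := [seq _ | _ <- _].
have size_w : size w = n by rewrite size_map size_enum_ord.
have nth_w (i : 'I_n) : nth 0%N w i = (2 * k - f i)%N.
  by rewrite (nth_map i) ?size_enum_ord // nth_ord_enum.

have le_f i : (f i <= 2 * k)%N by rewrite -ltnS.
pose om v := gapw (wx q t s k v) (wrho q t r s k v) (wtau q t s k v) (count (gtn v) w).
transitivity (\prod_(v < (2 * k).+1) \prod_(j < n | (2 * k - f j)%N == v)
    om v (count (predC1 (nat_of_ord v)) (take j w))).
  apply: eq_bigr => v _; rewrite /letw occw_prod.
  by rewrite size_w big_mkord; apply: eq_bigl => j; rewrite nth_w.
rewrite (exchange_big_dep predT) //=; apply: eq_bigr => j _.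
have lt_v : (2 * k - f j < (2 * k).+1)%N by rewrite ltnS leq_subr.
rewrite (big_pred1 (Ordinal lt_v)) => [|v]; last by rewrite /= eq_sym -val_eqE.
rewrite /om /wx /wrho /wtau /= subKn //.
have -> : odd (2 * k - f j) = odd (f j) by rewrite oddB // oddM.
case: (boolP (odd (f j))) => [_|ev]; first by rewrite /gapw !if_same mulrC.
have -> : count (gtn (2 * k - f j)%N) w = (\sum_(i < n) (f j < f i))%N.
  rewrite count_nth size_w big_mkord; apply: eq_bigr => i _; rewrite nth_w /=; congr nat_of_bool.
  by have := le_f i; have := le_f j; lia.
have -> : count (predC1 (2 * k - f j)%N) (take j w) = (\sum_(i < n | i < j) (f i != f j))%N.
  rewrite count_take_nth ?size_w 1?ltnW // big_mkord; apply: eq_bigr => i _.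
  rewrite nth_w /= -(inj_eq (@ord_inj _) (f i)); congr nat_of_bool.
  by have := le_f i; have := le_f j; lia.
have jE : nat_of_ord j
    = (\sum_(i < n | i < j) (f i != f j) + \sum_(i < n | i < j) (f i == f j))%N.
  rewrite -big_split -[LHS]sum_ord_lt; apply: eq_bigr => i _.
  by case: (_ == _).
have rE := rank_key ev.
move: (\sum_(i < n) _)%N (\sum_(i < n | _) (_ != _))%N (\sum_(i < n | _) (_ == _))%N jE rE.
move=> N c e jE rE.
rewrite /gapw jE rE ltn_add2r eqn_add2r.
by case: (ltngtP c N) => _; rewrite mulrC // mulr1.
Qed.


Let R_irr : irreflexive R.
Proof. by move=> i; apply: lexgt_irr. Qed.

Let R_trans : transitive R.
Proof. by move=> i j l; apply: lexgt_trans. Qed.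

Let R_total i j : i != j -> R i j || R j i.
Proof.
move=> neq_ij; rewrite /R /lexgt /=; case: ltngtP => // eq_f /=.
rewrite -eq_f -neq_lt; apply: contraNN neq_ij => /eqP eqY.
apply/eqP/val_inj; have := congr1 absz eqY.
by rewrite !absz_sign_letter => -[].
Qed.

(** Exactly one signed permutation is compatible with a given [f]: it sorts the keys and takes its
    signs from the parities. *)
Lemma sum_compatible_word :
  \sum_(w : signed_perm n | compatible w [ffun i => f (w.1 i)])
     \prod_i (entry_weight w i * q ^+ f (w.1 i))
  = wordw (wx q t s k) (wrho q t r s k) (wtau q t s k) (2 * k).+1
      [seq (2 * k - f i)%N | i <- enum 'I_n].
Proof.
have [u rank_u uP] := sorting_perm R_irr R_trans R_total.
pose w0 : signed_perm n := (u, [ffun i => odd (f (u i))]).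
rewrite (big_pred1 w0) => [|w].
  rewrite wordw_word [RHS](reindex_inj (@perm_inj _ u)); apply: eq_bigr => i _ /=.
  rewrite /entry_weight ffunE rank_u mulrC; congr (_ * _); case: ifP => // _.
  by rewrite -val_eqE eq_sym.
apply/andP/eqP => [[/forallP par /forallP srt]|->].
  have eps i : w.2 i = odd (f (w.1 i)) by have /eqP := par i; rewrite ffunE.
  case: w eps {par} srt => [u' e'] /= eps srt.
  have /uP eq_u : forall i j : 'I_n, (i < j)%N -> R (u' i) (u' j).
    move=> i j ltij; have /forallP/(_ j)/implyP/(_ ltij) := srt i.
    by rewrite /R /key /signed_letter /= !ffunE !eps.
  by rewrite /w0 -eq_u; congr (_, _); apply/ffunP => i; rewrite ffunE eps.
split; first by apply/forallP => i; rewrite !ffunE.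
apply/forallP => i; apply/forallP => j; apply/implyP => ltij.
by rewrite !ffunE /signed_letter /= !ffunE; apply: (iffRL (uP u)).
Qed.

End Word.

Lemma sum_compatible :
  \sum_(w : signed_perm n) \sum_(e | compatible w e)
     \prod_i (entry_weight w i * q ^+ e i)
  = \sum_(a <- words (2 * k).+1 n)
      wordw (wx q t s k) (wrho q t r s k) (wtau q t s k) (2 * k).+1 a.
Proof.
rewrite sum_words_ffun.
pose rv (f : {ffun 'I_n -> 'I_(2 * k).+1}) := [ffun i => rev_ord (f i)].
have rvK : involutive rv by move=> f; apply/ffunP => i; rewrite !ffunE rev_ordK.
rewrite [RHS](reindex_inj (inv_inj rvK)).
transitivity (\sum_(w : signed_perm n)
     \sum_(f : {ffun 'I_n -> 'I_(2 * k).+1} | compatible w [ffun i => f (w.1 i)])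
     \prod_i (entry_weight w i * q ^+ f (w.1 i))).
  apply: eq_bigr => w _.
  rewrite (reindex (fun f : {ffun 'I_n -> 'I_(2 * k).+1} => [ffun i => f (w.1 i)])) /=.
    by apply: eq_bigr => f _; apply: eq_bigr => i _; rewrite ffunE.
  exists (fun e : {ffun 'I_n -> 'I_(2 * k).+1} => [ffun i => e ((w.1^-1)%g i)]) => e _;
    by apply/ffunP => i; rewrite !ffunE ?permK ?permKV.
rewrite (exchange_big_dep predT) //=; apply: eq_bigr => f _.
rewrite sum_compatible_word; congr wordw; apply: eq_map => i.
by rewrite ffunE /= subSS.
Qed.

End Standardization.

(** * The flag major index from decreasing sequences *)

Section FlagMajor.
Variables (K : comUnitRingType) (q : K).

(** The value at a letter [y'] is written as [2 * c' + (y' < 0)]. The halves [c'] decrease weakly,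
    and strictly at descents. *)
Fixpoint chain_sum (y : int) (v : seq int) (c : nat) : K :=
  if v is y' :: v' then
    \sum_(c' < c.+1 - (y' < y)%R) q ^+ (2 * c' + (y' < 0)%R) * chain_sum y' v' c'
  else 1.

Definition parity_ok (a : nat * int) : bool := odd a.1 == (a.2 < 0)%R.

Lemma sum_parity (V : nmodType) (F : nat -> V) (b : bool) B :
  \sum_(0 <= e < 2 * B | odd e == b) F e = \sum_(c < B) F (2 * c + b)%N.
Proof.
elim: B => [|B IHB]; first by rewrite big_geq // big_ord0.
rewrite mulnS addnC addn2 big_mkcond !big_nat_recr //= -big_mkcond /= IHB big_ord_recr /=.
rewrite oddM /=; case: b {IHB} => /=; first by rewrite addr0 addn1.
by rewrite addr0 addn0.
Qed.

(** If [y' < y] the next value must be strictly smaller, otherwise at most equal. In the first case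
    [y < 0] forces [y' < 0], in the second the converse holds; so the condition passes to the halves
    with the same strictness. *)
Lemma sum_lexgt (V : nmodType) (F : nat -> V) (y y' : int) c k :
  y != y' -> (2 * c + (y < 0)%R < k)%N ->
  \sum_(0 <= e < k | lexgt ((2 * c + (y < 0)%R)%N, y) (e, y') && parity_ok (e, y')) F e
  = \sum_(c' < c.+1 - (y' < y)%R) F (2 * c' + (y' < 0)%R)%N.
Proof.
move=> neq_y lt_k; rewrite -sum_parity.
set B := (2 * (c.+1 - _))%N.
rewrite (@big_nat_widen _ _ _ 0 k (k + B)) ?leq_addr //.
rewrite [RHS](@big_nat_widen _ _ _ 0 B (k + B)) ?leq_addl //.
apply: eq_bigl => e; rewrite /lexgt /parity_ok /B {B} /=.
case: (ltgtP y' y) neq_y lt_k => [lt_yy|lt_yy|->]; rewrite ?eqxx // => _.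
  have : ((y < 0)%R ==> (y' < 0)%R) by apply/implyP; apply: lt_trans.
  by case: (y < 0)%R; case: (y' < 0)%R => //= _ lt_k; lia.
have : ((y' < 0)%R ==> (y < 0)%R) by apply/implyP; apply: lt_trans.
by case: (y < 0)%R; case: (y' < 0)%R => //= _ lt_k; lia.
Qed.

Lemma chain_sumE y v c k : uniq (y :: v) -> (2 * c + (y < 0)%R < k)%N ->
  chain_sum y v c = \sum_(l <- words k (size v) |
    path lexgt ((2 * c + (y < 0)%R)%N, y) (zip l v) && all parity_ok (zip l v)) q ^+ sumn l.
Proof.
elim: v y c => [|y' v IHv] y c uniq_v lt_k.
  by rewrite big_mkcond big_seq1.
have neq_y : y != y' by move: uniq_v; rewrite /= inE negb_or; case/andP => /andP[].
have uniq_v' : uniq (y' :: v) by case/andP: uniq_v.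
rewrite big_mkcond big_wordsS.
transitivity (\sum_(0 <= e < k | lexgt ((2 * c + (y < 0)%R)%N, y) (e, y') && parity_ok (e, y'))
   q ^+ e * chain_sum y' v e./2).
  rewrite sum_lexgt //=; apply: eq_bigr => c' _; congr (_ * chain_sum _ _ _).
  by case: (y' < 0)%R; lia.
rewrite big_mkcond big_nat [RHS]big_nat; apply: eq_bigr => e /andP[_ lt_e].
case: (boolP (parity_ok (e, y'))) => par; last first.
  by rewrite andbF big1 // => l _ /=; rewrite (negbTE par) !andbF.
have eE : e = (2 * e./2 + (y' < 0)%R)%N.
  by move: par; rewrite /parity_ok /= => /eqP <-; rewrite addnC mul2n odd_double_half.
rewrite andbT; case: (boolP (lexgt _ _)) => lex; last first.
  by rewrite big1 // => l _ /=; rewrite (negbTE lex).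
rewrite (IHv y' e./2) // -?eE // mulr_sumr big_mkcond; apply: eq_bigr => l _ /=.
by rewrite lex par /= exprD; case: ifP.
Qed.

Definition fps_scale (c : K) (f : {fps K}) : {fps K} := FPS (fun n => c ^+ n * f n).

Lemma fps_scaleM c : {morph fps_scale c : f g / f * g}.
Proof.
move=> f g; apply: fpsP => n; rewrite coef_fpsM /= mulr_sumr; apply: eq_bigr => i _.
by rewrite mulrACA -exprD subnKC // -ltnS.
Qed.

Lemma fps_scaleC c d : fps_scale c (fpsC d) = fpsC d.
Proof. by apply: fpsP => -[|n] /=; rewrite ?mul1r ?mulr0. Qed.

Lemma fps_scaleX c : fps_scale c (fpsX K) = fpsC c * fpsX K.
Proof.
apply: fpsP => n; rewrite coef_fpsCM /=.
by case: n => [|[|n]]; rewrite ?mulr0 ?mulr1 ?expr1.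
Qed.

Lemma fps_scaleB c f g : fps_scale c (f - g) = fps_scale c f - fps_scale c g.
Proof. by apply: fpsP => n; rewrite coef_fpsD coef_fpsN; apply: mulrBr. Qed.

(** With 0 as the letter in front, a negative first letter is a descent at position 0, so [desl 0]
    and [majl 0] are [desB] and [maj]. *)
Fixpoint desl (y : int) (v : seq int) : nat :=
  if v is y' :: v' then ((y' < y)%R + desl y' v')%N else 0.

Fixpoint majl (y : int) (v : seq int) : nat :=
  if v is y' :: v' then (majl y' v' + desl y' v')%N else 0.

(** A first letter contributes 1/(1 - X) from the summation, [X] if it follows a descent, and
    replaces [X] by [q ^+ 2 * X] in the series of the rest. This substitution shifts the product
    [qpoch] and multiplies by [q ^+ 2] for each later descent, which builds up [majl]. *)
Lemma chain_sum_qpoch y v :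
  FPS (chain_sum y v) * qpoch (fpsX K) (fpsC (q ^+ 2)) (size v).+1
  = fpsC (q ^+ (2 * majl y v + count (fun y => y < 0)%R v)) * fpsX K ^+ desl y v.
Proof.
elim: v y => [|y' v IHv] y /=.
  rewrite /qpoch big_ord1 expr0 mulr1 muln0 addn0 !expr0 mulr1.
  rewrite -[RHS](geoE 1) /lin rmorph1 mul1r; congr (_ * _).
  by apply: fpsP => n /=; rewrite expr1n.
have -> : FPS (chain_sum y (y' :: v))
  = fpsX K ^+ (y' < y)%R * geo 1 * fpsC (q ^+ (y' < 0)%R)
     * fps_scale (q ^+ 2) (FPS (chain_sum y' v)).
  apply: fpsP => c; rewrite -!mulrA coef_fpsXnM.
  have geo1 (f : {fps K}) n : (geo 1 * f) n = \sum_(i < n.+1) f i.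
    elim: n => [|n IHn]; first by rewrite geo0 big_ord1.
    by rewrite geoS mul1r IHn [RHS]big_ord_recr.
  rewrite geo1; set d : nat := (y' < y)%R.
  case: ifP => [le_dc|lt_cd]; last first.
    rewrite /= -/d (_ : c.+1 - d = 0)%N ?big_ord0 //.
    by move/negbT: lt_cd; rewrite -ltnNge; lia.
  rewrite [LHS]/= -/d subSn //; apply: eq_bigr => i _.
  by rewrite coef_fpsCM /= exprD exprM mulrA [_ ^+ (_ < _)%R * _]mulrC.
have -> : qpoch (fpsX K) (fpsC (q ^+ 2)) (size v).+2
  = (1 - fpsX K) * fps_scale (q ^+ 2) (qpoch (fpsX K) (fpsC (q ^+ 2)) (size v).+1).
  rewrite /qpoch big_ord_recl expr0 mulr1; congr (_ * _).
  have s1 : fps_scale (q ^+ 2) 1 = 1 by rewrite -(rmorph1 (@fpsC K)) fps_scaleC.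
  rewrite (big_morph _ (fps_scaleM _) s1); apply: eq_bigr => i _.
  have sC : fps_scale (q ^+ 2) (fpsC (q ^+ 2) ^+ i) = fpsC (q ^+ 2) ^+ i.
    by rewrite -rmorphXn fps_scaleC.
  by rewrite fps_scaleB s1 fps_scaleM fps_scaleX sC lift0 exprS; ring.
set A := FPS _ in IHv *; set Q := qpoch _ _ _ in IHv *.
transitivity (fpsX K ^+ (y' < y)%R * (geo 1 * (1 - lin 1))
   * fpsC (q ^+ (y' < 0)%R) * fps_scale (q ^+ 2) (A * Q)).
  by rewrite fps_scaleM /lin rmorph1 mul1r; ring.
rewrite geoE IHv fps_scaleM fps_scaleC.
have -> n : fps_scale (q ^+ 2) (fpsX K ^+ n) = fpsC (q ^+ (2 * n)) * fpsX K ^+ n.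
  elim: n => [|n IHn].
    by rewrite muln0 !expr0 -(rmorph1 (@fpsC K)) fps_scaleC -rmorphM mulr1.
  by rewrite [fpsX K ^+ n.+1]exprS fps_scaleM IHn fps_scaleX mulnS exprD rmorphM; ring.
by rewrite mulnDr !exprD !rmorphM /=; ring.
Qed.

End FlagMajor.

(** * Statistics of signed permutations as weights *)

Section SignedPermStatistics.
Variables (K : comUnitRingType) (n : nat).
Implicit Types w : signed_perm n.

Lemma wordE w : word w = [seq signed_letter w i | i <- enum 'I_n].
Proof. by []. Qed.

Lemma signed_letter_inj w : injective (signed_letter w).
Proof.
move=> i j /(congr1 absz); rewrite !absz_sign_letter => -[] /val_inj.
exact: perm_inj.
Qed.

Lemma signed_letter_neq0 w i : signed_letter w i != 0.
Proof. by rewrite -absz_eq0 absz_sign_letter. Qed.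

Lemma signed_letter_lt0 w i : (signed_letter w i < 0) = w.2 i.
Proof. exact: sign_letter_lt0. Qed.

(** The pair [(2 * k, 0)] in front encodes the bound on the values: the value [2 * k] is even, so
    its letter is positive and may follow 0. *)
Lemma compatible_path k w (e : {ffun 'I_n -> 'I_(2 * k).+1}) :
  let s := zip [seq nat_of_ord (e i) | i <- enum 'I_n] (word w) in
  compatible w e = path lexgt ((2 * k)%N, 0) s && all parity_ok s.
Proof.
move=> s; rewrite /s wordE zip_map {s}.
rewrite (path_sortedE lexgt_trans) (sorted_pairwise lexgt_trans) pairwise_map !all_map.
apply/andP/andP => [[/forallP par /forallP srt]|[/andP[_ srt] /allP par]].
  have par' i : odd (e i) = w.2 i by apply/eqP/par.
  split; last by apply/allP => i _; rewrite /parity_ok /= par' signed_letter_lt0.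
  apply/andP; split.
    apply/allP => i _; rewrite /lexgt /= orbC andbC.
    have := ltn_ord (e i); rewrite ltnS leq_eqVlt => /predU1P[eE|->]; last by rewrite orbT.
    rewrite eE eqxx /= lt_neqAle eq_sym signed_letter_neq0 leNgt signed_letter_lt0.
    by rewrite -par' eE oddM.
  case: n w e {par par'} srt => [|m] w e srt; first by rewrite /= enum_ord0.
  apply/(pairwiseP ord0) => i j; rewrite !inE size_enum_ord => lt_i lt_j lt_ij.
  have /forallP/(_ (Ordinal lt_j))/implyP/(_ lt_ij) := srt (Ordinal lt_i).
  by rewrite (nth_ord_enum ord0 (Ordinal lt_i)) (nth_ord_enum ord0 (Ordinal lt_j)).
split; apply/forallP => i.
  by have := par i; rewrite -enumT mem_enum => /(_ isT); rewrite /parity_ok /= signed_letter_lt0.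
apply/forallP => j; apply/implyP => lt_ij.
have /(pairwiseP i)/(_ i j) := srt; rewrite !inE size_enum_ord !nth_ord_enum.
by apply.
Qed.

Lemma sum_compatible_chain (q : K) k w :
  \sum_(e : {ffun 'I_n -> 'I_(2 * k).+1} | compatible w e) \prod_(i < n) q ^+ e i
    = chain_sum q 0 (word w) k.
Proof.
rewrite (@chain_sumE _ _ _ _ _ (2 * k).+1) ?ltxx ?addn0 //; last first.
  rewrite /= wordE map_inj_uniq ?enum_uniq ?andbT; last exact: signed_letter_inj.
  by apply/mapP => -[i _ /esym/eqP]; rewrite (negbTE (signed_letter_neq0 _ _)).
rewrite size_word big_mkcond [RHS]big_mkcond sum_words_ffun; apply: eq_bigr => e _.
rewrite compatible_path; case: ifP => // _.
by rewrite sumnE big_map big_enum /= expr_sum.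
Qed.

Lemma count_letter (P : int -> nat -> bool) w :
  count (fun i => P (letter (word w) i) i) (index_iota 1 (size (word w)).+1)
    = (\sum_(i < n) P (signed_letter w i) i.+1)%N.
Proof.
rewrite -sum1_count size_word big_mkcond big_add1 big_mkord; apply: eq_bigr => i _.
by rewrite /letter /= (nth_word w i); case: (P _ _).
Qed.

Lemma prod_entry_weight (t r s : K) w :
  \prod_(i < n) entry_weight t r s w i
    = t ^+ fexc (word w) * r ^+ fixp (word w) * s ^+ neg (word w).
Proof.
rewrite /fexc /exc /fixp /neg.
rewrite (count_letter (fun x i => i%:Z < x)) (count_letter (fun x i => x == i%:Z)).
rewrite (count_letter (fun x _ => x < 0)).
rewrite exprD exprM !expr_sum -!big_split; apply: eq_bigr => i _ /=.
rewrite /entry_weight signed_letter_lt0 /signed_letter.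
case: (w.2 i) => /=; first by ring.
rewrite expr0 mul1r ltz_nat eqz_nat ltnS eqSS val_eqE.
case: ltngtP => [lt|lt|/ord_inj eq_i].
- by rewrite (_ : w.1 i == i = false) ?mulr1 ?expr1 // -(inj_eq (@ord_inj n)); lia.
- by rewrite (_ : w.1 i == i = false) ?mulr1 // -(inj_eq (@ord_inj n)); lia.
by rewrite -eq_i eqxx !mulr1 mul1r.
Qed.

Lemma desl_sum y (v : seq int) :
  desl y v = (\sum_(0 <= i < size v) (nth 0 v i < nth 0 (y :: v) i)%R)%N.
Proof.
elim: v y => [|y' v IHv] y /=; first by rewrite big_geq.
by rewrite big_nat_recl //= IHv.
Qed.

Lemma majl_sum y (v : seq int) :
  majl y v = (\sum_(0 <= i < size v) i * (nth 0 v i < nth 0 (y :: v) i)%R)%N.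
Proof.
elim: v y => [|y' v IHv] y /=; first by rewrite big_geq.
rewrite big_nat_recl //= mul0n add0n IHv desl_sum -big_split /=.
by apply: eq_bigr => i _; rewrite mulSn addnC.
Qed.

Lemma desB_desl (v : seq int) : desB v = desl 0 v.
Proof.
rewrite /desB /des size_filter -sum1_count big_mkcond desl_sum.
case: v => [|y v] /=; first by rewrite !big_geq.
by rewrite addnC [RHS]big_nat_recl // big_add1.
Qed.

Lemma maj_majl (v : seq int) : maj v = majl 0 v.
Proof.
rewrite /maj big_filter big_mkcond majl_sum.
case: v => [|y v] /=; first by rewrite !big_geq.
rewrite [RHS]big_nat_recl // mul0n add0n big_add1.
by apply: eq_bigr => i _; rewrite /letter /=; case: (_ < _)%R; rewrite ?muln1 ?muln0.
Qed.

Lemma neg_count w : neg (word w) = count (fun y => y < 0)%R (word w).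
Proof.
rewrite /neg (count_letter (fun x _ => x < 0)) -sum1_count wordE big_map [RHS]big_mkcond.
by rewrite big_enum; apply: eq_bigr => i _; case: (_ < _)%R.
Qed.

End SignedPermStatistics.

(** * The coefficients of the left-hand side *)

Section Assembly.
Variables (K : comUnitRingType) (q t r s : K).

Lemma qpochX_unit n : qpoch (fpsX K) (fpsC (q ^+ 2)) n \is a GRing.unit.
Proof.
rewrite /qpoch; elim/big_rec: _ => [|i y _ yU]; first exact: unitr1.
rewrite unitrM yU andbT; exact/unit_fps1B/vanish_mulr/vanishX.
Qed.

Lemma signed_perm_series n (w : signed_perm n) :
  fpsC (q ^+ fmaj (word w)) * fpsX K ^+ desB (word w)
    / qpoch (fpsX K) (fpsC (q ^+ 2)) n.+1
  = FPS (chain_sum q 0 (word w)).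
Proof.
apply: (mulIr (qpochX_unit n.+1)); rewrite mulrVK ?qpochX_unit //.
have := chain_sum_qpoch q 0 (word w); rewrite [X in qpoch _ _ X.+1]size_word => ->.
by rewrite desB_desl /fmaj maj_majl neg_count.
Qed.

Lemma sum_words_noblank j n (F : seq nat -> K) :
  \sum_(w <- words j.+1 n | count_mem j w == 0%N) F w = \sum_(w <- words j n) F w.
Proof.
elim: n F => [|n IHn] F; first by rewrite big_mkcond !big_seq1.
rewrite big_mkcond !big_wordsS big_nat_recr //= [X in _ + X]big1 ?addr0; last first.
  by move=> w _; rewrite eqxx.
rewrite big_nat [RHS]big_nat; apply: eq_bigr => v /andP[_ lt_vj].
rewrite -IHn [RHS]big_mkcond; apply: eq_bigr => w _.
by rewrite (ltn_eqF lt_vj).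
Qed.

(** Words over [(2 * k).+1] letters are words with one further letter, the blank, that does not
    occur: the case [m = 0] of [Fsum_elimG]. *)
Lemma signed_perm_sum n k :
  \sum_(w : signed_perm n)
     t ^+ fexc (word w) * r ^+ fixp (word w) * s ^+ neg (word w)
       * chain_sum q 0 (word w) k
  = (elimG (wx q t s k) (wrho q t r s k) (wtau q t s k) (2 * k).+1).1 n.
Proof.
transitivity (\sum_(w : signed_perm n) \sum_(e | compatible w e)
     \prod_(i < n) (entry_weight t r s w i * q ^+ (e : {ffun 'I_n -> 'I_(2 * k).+1}) i)).
  apply: eq_bigr => w _; rewrite -sum_compatible_chain mulr_sumr -prod_entry_weight.
  by apply: eq_bigr => e _; rewrite big_split.
rewrite sum_compatible -sum_words_noblank.
set G := elimG _ _ _ _.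
by rewrite -[G.1]mulr1 -(expr0 G.2) -Fsum_elimG /Fsum addn0.
Qed.

End Assembly.

(** * Series in two variables *)

Section CoefficientwiseConstant.
Variable K : comUnitRingType.

Definition fps2_of_z (f : {fps K}) : {fps2 K} := FPS (fun i => fpsC (f i)).

Lemma fps2_of_z_is_zmod_morphism : zmod_morphism fps2_of_z.
Proof. by move=> f g; apply: fpsP => i; apply: rmorphB. Qed.

Lemma fps2_of_zC c : fps2_of_z (fpsC c) = fps2C c.
Proof. by apply: fpsP => -[|i] //=; rewrite rmorph0. Qed.

Lemma fps2_of_z_is_monoid_morphism : monoid_morphism fps2_of_z.
Proof.
split=> [|f g]; first by rewrite -(rmorph1 (@fpsC K)) fps2_of_zC /fps2C !rmorph1.
apply: fpsP => i; rewrite coef_fpsM /= rmorph_sum; apply: eq_bigr => l _.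
exact: rmorphM.
Qed.

HB.instance Definition _ := GRing.isZmodMorphism.Build {fps K} {fps2 K}
  fps2_of_z fps2_of_z_is_zmod_morphism.
HB.instance Definition _ := GRing.isMonoidMorphism.Build {fps K} {fps2 K}
  fps2_of_z fps2_of_z_is_monoid_morphism.

Lemma fps2_of_zX : fps2_of_z (fpsX K) = fps2z.
Proof. by apply: fpsP => i /=; case: (i == 1%N); rewrite ?rmorph1 ?rmorph0. Qed.

Lemma rmorph_qpoch (A B : comNzRingType) (phi : {rmorphism A -> B}) a c n :
  phi (qpoch a c n) = qpoch (phi a) (phi c) n.
Proof.
rewrite /qpoch rmorph_prod; apply: eq_bigr => i _.
by rewrite rmorphB rmorph1 rmorphM rmorphXn.
Qed.

Lemma coef_fps2pXM k (f : {fps K}) i j :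
  (fps2p ^+ k * fps2_of_z f) i j = if j == k then f i else 0.
Proof.
rewrite /fps2p -rmorphXn coef_fpsCM coef_fpsXnM; case: ltngtP => [lt|lt|->] //.
  by have -> : (j - k = (j - k).-1.+1)%N by lia.
by rewrite subnn.
Qed.

Lemma coef_fps2zXM n (f : {fps K}) i j :
  (fps2z ^+ n * fpsC f) i j = if i == n then f j else 0.
Proof.
rewrite /fps2z coef_fpsXnM; case: ltngtP => [lt|lt|->] //.
  by have -> : (i - n = (i - n).-1.+1)%N by lia.
by rewrite subnn.
Qed.

End CoefficientwiseConstant.

Theorem corollary1p7 (K : comUnitRingType) (q0 t0 r0 s0 : K)
  (Uqt : 1 - t0 ^+ 2 * q0 ^+ 2 \is a GRing.unit) :
  let z : {fps2 K} := fps2z in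
  let p : {fps2 K} := fps2p in
  let q : {fps2 K} := fps2C q0 in
  let t : {fps2 K} := fps2C t0 in
  let r : {fps2 K} := fps2C r0 in
  let s : {fps2 K} := fps2C s0 in
  exists S : {fps2 K},
    is_fps2_sum (fun n : nat =>
      \sum_(w : signed_perm n)
        z ^+ n / qpoch p (q ^+ 2) n.+1
          * q ^+ fmaj (word w) * t ^+ fexc (word w) * p ^+ desB (word w)
          * r ^+ fixp (word w) * s ^+ neg (word w)) S
    /\
    is_fps2_sum (fun k : nat =>
      (p ^+ k * (1 - t ^+ 2 * q ^+ 2)
         * qpoch z (q ^+ 2) k * qpoch (t ^+ 2 * q ^+ 2 * z) (q ^+ 2) k)
      / (qpoch (r * z) (q ^+ 2) k.+1
           * ((1 + s * q * t) * qpoch z (q ^+ 2) k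
              - (t ^+ 2 * q ^+ 2 + s * q * t)
                  * qpoch (t ^+ 2 * q ^+ 2 * z) (q ^+ 2) k))) S.
Proof.
move=> z p q t r s.
pose G k := (elimG (wx q0 t0 s0 k) (wrho q0 t0 r0 s0 k) (wtau q0 t0 s0 k) (2 * k).+1).1.
(* On the right, the summand of index [k] is [p ^+ k] times a series in [z] alone, so only [k = j]
   contributes to the coefficient of z^i p^j. *)
exists (FPS (fun i => FPS (fun j => G j i))); split=> i j; last first.
  exists j.+1 => M lt_jM.
  rewrite coef_fps_sum coef_fps_sum (bigD1 (Ordinal lt_jM)) //.
  have termE k : (p ^+ k * (1 - t ^+ 2 * q ^+ 2)
         * qpoch z (q ^+ 2) k * qpoch (t ^+ 2 * q ^+ 2 * z) (q ^+ 2) k)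
      / (qpoch (r * z) (q ^+ 2) k.+1
           * ((1 + s * q * t) * qpoch z (q ^+ 2) k
              - (t ^+ 2 * q ^+ 2 + s * q * t)
                  * qpoch (t ^+ 2 * q ^+ 2 * z) (q ^+ 2) k))
    = p ^+ k * fps2_of_z (G k).
    rewrite /G (elimG_closed r0 s0 k Uqt) rmorphM rmorphV ?closed_den_unit //.
    have q2E : fps2_of_z (fpsC (q0 ^+ 2)) = q ^+ 2.
      by rewrite fps2_of_zC /fps2C !rmorphXn.
    have aE : fps2_of_z (fpsC (t0 ^+ 2 * q0 ^+ 2)) = t ^+ 2 * q ^+ 2.
      by rewrite fps2_of_zC /fps2C !(rmorphM, rmorphXn).
    have bE : fps2_of_z (fpsC (s0 * q0 * t0)) = s * q * t.
      by rewrite fps2_of_zC /fps2C !rmorphM.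
    move: (fpsC (q0 ^+ 2)) (fpsC (t0 ^+ 2 * q0 ^+ 2)) (fpsC (s0 * q0 * t0)) q2E aE bE.
    move=> q2 a b q2E aE bE.
    rewrite !(rmorphM, rmorphB, rmorphD, rmorph1, rmorph_qpoch) /= q2E aE bE.
    by rewrite fps2_of_zC fps2_of_zX !mulrA.
  rewrite termE coef_fps2pXM eqxx big1 => [|k neq_k]; first exact: addr0.
  rewrite termE coef_fps2pXM ifN //; apply: contraNneq neq_k => eq_jk.
  exact/eqP/val_inj.
(* On the left, the summand of index [n] is [z ^+ n] times a series in [p] alone, so only [n = i]
   contributes. *)
exists i.+1 => M lt_iM.
have termE n (w : signed_perm n) :
    z ^+ n / qpoch p (q ^+ 2) n.+1
      * q ^+ fmaj (word w) * t ^+ fexc (word w) * p ^+ desB (word w)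
      * r ^+ fixp (word w) * s ^+ neg (word w)
    = z ^+ n * fpsC (fpsC (t0 ^+ fexc (word w) * r0 ^+ fixp (word w) * s0 ^+ neg (word w))
        * FPS (chain_sum q0 0 (word w))).
  rewrite -signed_perm_series.
  have qpE : qpoch p (q ^+ 2) n.+1 = fpsC (qpoch (fpsX K) (fpsC (q0 ^+ 2)) n.+1).
    by rewrite rmorph_qpoch /= /q /fps2C !rmorphXn.
  rewrite qpE; set Q := qpoch _ _ _.
  have VE : fpsC Q^-1 = (fpsC Q)^-1 by rewrite rmorphV ?qpochX_unit.
  rewrite !rmorphM /= VE !rmorphXn /= -/p /q /t /r /s /fps2C -/(fps2p).
  by ring.
rewrite coef_fps_sum coef_fps_sum.
transitivity (\sum_(n < M | n == Ordinal lt_iM) G j n); last by rewrite big_pred1_eq.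
rewrite [RHS]big_mkcond; apply: eq_bigr => n _; rewrite !coef_fps_sum.
case: eqVneq => [-> | neq_n].
  rewrite /G -signed_perm_sum; apply: eq_bigr => w _.
  by rewrite termE coef_fps2zXM eqxx coef_fpsCM.
rewrite big1 // => w _; rewrite termE coef_fps2zXM ifN //.
by apply: contraNneq neq_n => eq_in; apply/eqP/val_inj.
Qed.
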